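(* Let $n \geq 2$. There exists $C \in \mathcal{K}^n_r$ such that $\partial C$ is a $\mathcal{C}^{1,1}$-hypersurface and $\overline{\Sigma(\partial C)}$ has non-empty interior, and moreover such that the function $u : \mathbf{R}^n \to \mathbf{R}$ defined by $$u(x) = \delta_{\partial C}(x) \quad \text{for } x \in C, \qquad u(x) = -\delta_{\partial C}(x) \quad \text{for } x \in \mathbf{R}^n \setminus C$$ is a viscosity solution of the Eikonal equation $|\nabla u|^2 = 1$ on $\mathbf{R}^n$ and the closure of the set of points where $u$ is not differentiable has non-empty interior.
   Context: $\mathcal{K}^n_r$ is the set of all compact convex subsets $C$ of $\mathbf{R}^n$ with non-empty interior such that $\partial C$ is a $\mathcal{C}^1$-hypersurface. For an integer $k\ge 1$ and $0 \le \alpha \le 1$, a set $M \subseteq \mathbf{R}^n$ is a $\mathcal{C}^{k,\alpha}$-hypersurface if for every $a \in M$ there exist an open set $U \subseteq \mathbf{R}^n$ containing $a$, an $(n-1)$-dimensional linear subspace $Z$ of $\mathbf{R}^n$, and a $\mathcal{C}^{k,\alpha}$-diffeomorphism $\sigma : U \to \sigma(U)$ onto an open subset of $\mathbf{R}^n$ (i.e. $\sigma$ and $\sigma^{-1}$ are both of class $\mathcal{C}^{k,\alpha}$) such that $\sigma(U \cap M) = Z \cap \sigma(U)$. Here $\mathcal{C}^1 = \mathcal{C}^{1,0}$, and $\mathcal{C}^{1,1}$ means continuously differentiable with locally Lipschitz derivative. For a non-empty closed set $K \subseteq \mathbf{R}^n$, $\delta_K(x) = \inf\{|x-a| : a \in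 K\}$ is the distance function from $K$, and its singular set is $\Sigma(K) = \{x \in \mathbf{R}^n \setminus K : \delta_K \text{ is not differentiable at } x\}$; $\overline{\Sigma(K)}$ is its closure in $\mathbf{R}^n$. A continuous function $u$ on an open set $W \subseteq \mathbf{R}^n$ is a viscosity solution of $|\nabla u|^2 = 1$ on $W$ (standard convention, for the equation $|\nabla u|^2 - 1 = 0$) if for every $x \in W$ and every $\mathcal{C}^1$ function $\varphi$ defined near $x$: if $u - \varphi$ has a local maximum at $x$ then $|\nabla\varphi(x)|^2 \leq 1$, and if $u - \varphi$ has a local minimum at $x$ then $|\nabla\varphi(x)|^2 \geq 1$. *)

(* Defs.v *)
From HB Require Import structures.
From mathcomp Require Import all_boot all_order all_algebra.
From mathcomp Require Import all_classical all_reals all_analysis.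

Set Implicit Arguments.
Unset Strict Implicit.
Unset Printing Implicit Defensive.

Import Order.TTheory GRing.Theory Num.Theory.
Import numFieldNormedType.Exports.

Local Open Scope classical_set_scope.
Local Open Scope ring_scope.

(* R^n is 'rV[R]_n. Its library norm is the sup norm, which induces the usual
   topology and the usual notions of differentiability and of Lipschitz
   continuity; wherever the value of the norm matters, enorm is used. *)
Definition enorm (R : realType) (n : nat) (x : 'rV[R]_n) : R :=
  Num.sqrt (\sum_(i < n) x 0 i ^+ 2).

Definition boundary (T : topologicalType) (A : set T) : set T :=
  closure A `\` A°.

(* In the next two definitions U is meant to be open. *)
Definition C1_on (R : realType) (n m : nat) (U : set 'rV[R]_n)
    (f : 'rV[R]_n -> 'rV[R]_m) : Prop :=
  forall x, U x -> differentiable f x /\ {for x, continuous (jacobian f)}.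

Definition C11_on (R : realType) (n m : nat) (U : set 'rV[R]_n)
    (f : 'rV[R]_n -> 'rV[R]_m) : Prop :=
  C1_on U f /\
  forall x, U x -> exists2 V, nbhs x V & [lipschitz (jacobian f) y | y in V].

(* [class U f] is a regularity class of maps on open sets, C1_on or C11_on
   below; [tau] plays the role of the inverse of [sigma : U -> sigma(U)]. *)
Definition diffeo_on (R : realType) (n : nat)
    (class : set 'rV[R]_n -> ('rV[R]_n -> 'rV[R]_n) -> Prop)
    (U : set 'rV[R]_n) (sigma : 'rV[R]_n -> 'rV[R]_n) : Prop :=
  [/\ open U, open (sigma @` U), class U sigma &
      exists2 tau, {in U, cancel sigma tau} & class (sigma @` U) tau].

Definition hypersurface (R : realType) (n : nat)
    (class : set 'rV[R]_n -> ('rV[R]_n -> 'rV[R]_n) -> Prop)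
    (M : set 'rV[R]_n) : Prop :=
  forall a, M a ->
    exists (U : set 'rV[R]_n) (Z : {vspace 'rV[R]_n})
           (sigma : 'rV[R]_n -> 'rV[R]_n),
      [/\ U a, \dim Z = n.-1, diffeo_on class U sigma &
          sigma @` (U `&` M) = [set z | z \in Z] `&` sigma @` U].

Definition C1_hypersurface (R : realType) (n : nat) (M : set 'rV[R]_n) : Prop :=
  hypersurface (@C1_on R n n) M.

Definition C11_hypersurface (R : realType) (n : nat) (M : set 'rV[R]_n) : Prop :=
  hypersurface (@C11_on R n n) M.

Definition regular_convex_body (R : realType) (n : nat) (C : set 'rV[R]_n) : Prop :=
  [/\ compact C, convex_set (C : set (convex_lmodType 'rV[R]_n)),
      C° !=set0 & C1_hypersurface (boundary C)].

Definition dist (R : realType) (n : nat) (K : set 'rV[R]_n) (x : 'rV[R]_n) : R :=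
  inf [set enorm (x - a) | a in K].

Definition singular_set (R : realType) (n : nat) (K : set 'rV[R]_n) :
    set 'rV[R]_n :=
  [set x | ~ K x /\ ~ differentiable (dist K) x].

Definition signed_dist (R : realType) (n : nat) (C : set 'rV[R]_n)
    (x : 'rV[R]_n) : R :=
  if x \in C then dist (boundary C) x else - dist (boundary C) x.

Definition gradient (R : realType) (n : nat) (f : 'rV[R]_n -> R)
    (x : 'rV[R]_n) : 'rV[R]_n :=
  \row_(i < n) 'D_(delta_mx 0 i) f x.

Definition C1_near (R : realType) (n : nat) (f : 'rV[R]_n -> R)
    (x : 'rV[R]_n) : Prop :=
  \forall y \near x, differentiable f y /\ {for y, continuous (gradient f)}.

(* W is meant to be open. *)
Definition eikonal_viscosity_solution (R : realType) (n : nat)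
    (W : set 'rV[R]_n) (u : 'rV[R]_n -> R) : Prop :=
  {within W, continuous u} /\
  forall x (phi : 'rV[R]_n -> R), W x -> C1_near phi x ->
    ((\forall y \near x, u y - phi y <= u x - phi x) ->
       enorm (gradient phi x) ^+ 2 <= 1) /\
    ((\forall y \near x, u x - phi x <= u y - phi y) ->
       1 <= enorm (gradient phi x) ^+ 2).

(* Main.v *)
Require Import Defs.
From HB Require Import structures.
From mathcomp Require Import all_boot all_order all_algebra.
From mathcomp Require Import all_classical all_reals all_analysis.
From mathcomp Require Import ring lra.

Set Implicit Arguments.
Unset Strict Implicit.
Unset Printing Implicit Defensive.

Import Order.TTheory GRing.Theory Num.Theory.
Import numFieldNormedType.Exports.

Local Open Scope classical_set_scope.
Local Open Scope ring_scope.

(** The body is the sublevel set, at level 1, of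
      z |-> sum_j flat (z_j) + eta (z_0),
    where flat t is the squared distance of t from [-2, 2] and eta is a small
    convex function of one variable. With eta = 0 this is the unit
    neighbourhood of the cube [-2, 2]^n, with eta its boundary is dented
    slightly along the first axis.

    eta comes from a dense open subset V of ]-2, 2[ of small measure: eta' (x)
    is 4 times the measure of the part of V below x [densely_curved]. Thus eta'
    is Lipschitz and small, yet eta has second derivative 4 on a dense set.
    Since eta' is Lipschitz the boundary is of class C^{1,1}: at a boundary
    point some coordinate lies outside [-2, 2], the equation is there of the
    form (z_i - b)^2 + (a function of the other coordinates) = 1, and it is
    straightened by an explicit diffeomorphism whose inverse is a square root
    [graph_hypersurface].

    Singularities. Let x be a little below the face z_1 = 2 of the cube. A
    boundary point of first coordinate s in ]-2, 2[ has squared distance at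
    least
      D (s) = (x_0 - s)^2 + (2 - x_1 + W (s))^2, W (s) = sqrt (1 - eta (s)),
    from x, with equality for a suitable one, so the first coordinate of a
    nearest point minimizes D. Since W is concave, the second difference of D
    with step h is at most 2 h^2 minus that of eta; it is negative at the
    points of V, so the first coordinate of a nearest point is never in V
    [nearest_point_not_curved].
    On the other hand D has different minimizers for x and for its translates
    along the first axis [nearest_point_moves]. Hence, while x moves along a
    short segment parallel to that axis, the first coordinate of its nearest
    point has to jump over a value in V. By the intermediate value theorem
    there is a point on the segment which is equally far from the two parts
    into which that value cuts the boundary. It has two nearest points, so the
    distance is not differentiable there [differentiable_dist_unique]. As the
    segment is arbitrarily short, such points are dense in a ball
    [singular_dense].

    The Eikonal equation holds for every body of this kind
    [signed_dist_eikonal]: the signed distance is 1-Lipschitz, which bounds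
    from above the gradients of the functions touching it from above, and from
    every point starts a direction along which it decreases with unit speed
    (towards a nearest boundary point in the interior, along an outer normal
    elsewhere), which bounds from below the gradients of the functions touching
    it from below. *)

(** * A convex function of one variable curved on a dense set *)

(** Outer regularity of the Lebesgue measure at the null set of rationals gives
    a dense open set of small measure. *)
Lemma small_dense_open (R : realType) (e : R) : 0 < e ->
  exists V : set R, [/\ open V, V `<=` `]-2, 2[,
    (lebesgue_measure V <= e%:E)%E &
    forall a b : R, -2 <= a -> a < b -> b <= 2 ->
      exists s h : R, [/\ a < s < b, 0 < h & `]s - h, s + h[ `<=` V]].
Proof.
move=> e0.
pose Q : set R := range (@ratr R).
have cQ : countable Q by exact/(card_le_trans (card_image_le _ _))/countableP.
have mQ : measurable Q by exact: countable_measurable.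
have Q0 : lebesgue_measure Q = 0%E by exact: countable_lebesgue_measure0.
have [] := @lebesgue_regularity_outer R Q e mQ _ e0.
  by rewrite [X in (X < _)%E](_ : _ = 0%E) // Q0.
move=> U [oU QU]; rewrite -/(_ `\` _) => UQ.
exists (U `&` `]-2, 2[); split.
- exact: openI.
- exact: subIsetr.
- have mU : measurable U := measurable_realfun.open_measurable oU.
  apply: (@le_trans _ _ (lebesgue_measure (U `\` Q `|` Q))).
    apply: le_measure; rewrite ?inE.
    + by apply: measurableI => //; exact: measurable_itv.
    + by apply: measurableU => //; exact: measurableD.
    + by move=> x [Ux _]; have [|] := pselect (Q x); [right|left].
  apply: (le_trans (measureU2 _ _ _)) => //; first exact: measurableD.
  by rewrite [X in (_ + X)%E](_ : _ = 0%E) ?adde0; [exact/ltW|exact: Q0].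
- move=> a b a2 ab b2.
  have [q] := rat_in_itvoo ab; rewrite inE /= => /andP[]; rewrite !bnd_simp => aq qb.
  have : nbhs (ratr q : R) (U `&` `]-2, 2[).
    apply: open_nbhs_nbhs; split; first exact: openI.
    split; first by apply: QU; exists q.
    by rewrite /= in_itv /= (le_lt_trans a2 aq) (lt_le_trans qb b2).
  rewrite -nbhs_ballE => -[h /= h0 hU].
  exists (ratr q), h; split => //; first by rewrite aq qb.
  move=> x /=; rewrite in_itv /= => /andP[x1 x2]; apply: hU.
  by rewrite /ball /= ltr_norml; apply/andP; split; lra.
Qed.

(** [s x] is the measure of the part of [V] below [x]: its slope is 1 on the
    intervals inside [V], although its total increase is at most [e]. *)
Lemma distribution_function (R : realType) (V : set R) (e : R) : open V ->
    V `<=` `]-2, 2[ -> (lebesgue_measure V <= e%:E)%E ->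
  exists s : R -> R,
    [/\ forall x y : R, x <= y -> 0 <= s y - s x <= y - x,
        forall x y : R, x <= y -> `]x, y[ `<=` V -> s y - s x = y - x,
        forall x : R, 0 <= s x <= e,
        forall x : R, x <= -2 -> s x = 0 &
        forall x : R, 2 <= x -> s x = s 2].
Proof.
move=> oV V2 Ve.
pose mu := (@lebesgue_measure R).
have mV : measurable V := measurable_realfun.open_measurable oV.
have mI (i : interval R) : measurable (V `&` [set` i]).
  by apply: measurableI => //; exact: measurable_itv.
have muI (i : interval R) : (mu (V `&` [set` i]) <= e%:E)%E.
  by apply: le_trans Ve; apply: le_measure; rewrite ?inE; [exact: mI|exact: mV|exact: subIsetl].
have fI (i : interval R) : mu (V `&` [set` i]) \is a fin_num.
  by rewrite ge0_fin_numE ?measure_ge0 // (le_lt_trans (muI i)) ?ltry.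
pose s x := fine (mu (V `&` `]-oo, x])).
have sB x y : x <= y -> s y - s x = fine (mu (V `&` `]x, y])).
  move=> xy; rewrite /s.
  have -> : V `&` `]-oo, y] = (V `&` `]-oo, x]) `|` (V `&` `]x, y]).
    rewrite -setIUr; congr (_ `&` _); apply/seteqP; split=> z /=; rewrite !in_itv /=.
      by move=> zy; have [zx|xz] := leP z x; [left|right; rewrite zy].
    by move=> [zx|/andP[]//]; exact: le_trans zx xy.
  have -> : mu ((V `&` `]-oo, x]) `|` (V `&` `]x, y])) =
      (mu (V `&` `]-oo, x]) + mu (V `&` `]x, y]))%E.
    apply: measureU; [exact: mI|exact: mI|].
    apply/seteqP; split=> // z /= [[_ +] [_]]; rewrite !in_itv /= => zx.
    by rewrite ltNge zx.
  by rewrite fineD ?fI // addrC addKr.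
have len (x y : R) : x <= y -> mu [set` `]x, y]] = (y - x)%:E.
  move=> xy; rewrite /mu lebesgue_measure_itv /= lte_fin.
  by case: ltgtP xy => // -> _; rewrite subrr.
exists s; split.
- move=> x y xy; rewrite sB // fine_ge0 ?measure_ge0 //=.
  rewrite -lee_fin fineK ?fI // -len //.
  apply: le_measure; rewrite ?inE; [exact: mI|exact: measurable_itv|exact: subIsetr].
- move=> x y xy xyV; rewrite sB //; apply: EFin_inj; rewrite fineK ?fI //.
  apply/eqP; rewrite eq_le; apply/andP; split.
    rewrite -len //; apply: le_measure; rewrite ?inE;
      [exact: mI|exact: measurable_itv|exact: subIsetr].
  have -> : (y - x)%:E = mu [set` `]x, y[].
    rewrite /mu lebesgue_measure_itv /= lte_fin.
    by case: ltgtP xy => // -> _; rewrite subrr.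
  apply: le_measure; rewrite ?inE; [exact: measurable_itv|exact: mI|].
  move=> z zxy; split; first exact: xyV.
  by move: zxy; rewrite /= !in_itv /= => /andP[-> /ltW].
- move=> x; rewrite fine_ge0 ?measure_ge0 //=.
  by rewrite -lee_fin fineK ?fI.
- move=> x x2; rewrite /s; have -> : V `&` `]-oo, x] = set0; last first.
    by rewrite (_ : mu set0 = 0%E) //; exact: measure0.
  apply/seteqP; split=> // z /= [/V2 /=]; rewrite !in_itv /= => /andP[z2 _] zx.
  by have := lt_le_trans z2 (le_trans zx x2); rewrite ltxx.
- move=> x x2; rewrite /s; congr (fine (mu _)).
  apply/seteqP; split=> z /= [Vz _]; split=> //; have := V2 _ Vz;
    rewrite /= !in_itv /= => /andP[_ z2].
    exact: ltW.
  exact: le_trans (ltW z2) x2.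
Qed.

(** As [s] vanishes below [a], so does its integral from [a - 1], also to the
    left of [a - 1], where the interval of integration is empty; this makes the
    integral an antiderivative on the whole line. *)
Lemma lipschitz_antiderivative (R : realType) (s : R -> R) (k a : R) :
    (forall x y : R, x <= y -> 0 <= s y - s x <= k * (y - x)) ->
    (forall x : R, x <= a -> s x = 0) ->
  exists f : R -> R, (forall x : R, is_derive x 1 f (s x)) /\
    (forall x, x <= a -> f x = 0).
Proof.
move=> sL s0.
have cs : continuous s.
  move=> x; apply/cvgrPdist_le => e e0.
  have k0 : 0 < `|k| + 1 by rewrite ltr_pwDr.
  near=> y.
  have xy : `|x - y| <= e / (`|k| + 1).
    near: y; apply: cvgr_dist_le; [exact: cvg_id|exact: divr_gt0].
  have kk : k * `|x - y| <= e.
    apply: (@le_trans _ _ ((`|k| + 1) * `|x - y|)).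
      by apply: ler_wpM2r => //; have := ler_norm k; lra.
    by rewrite mulrC -ler_pdivlMr.
  have [yx|xy'] := leP y x.
    move: kk; have /andP[s1 s2] := sL _ _ yx.
    by rewrite ger0_norm ?subr_ge0 // => kk; rewrite ger0_norm //; exact: le_trans kk.
  have /andP[s1 s2] := sL _ _ (ltW xy').
  move: kk; rewrite distrC ger0_norm; last by rewrite subr_ge0; exact: ltW.
  move=> kk.
  by rewrite distrC ger0_norm //; exact: le_trans kk.
have int (u v : R) : lebesgue_measure.-integrable `[u, v] (EFin \o s).
  apply: continuous_compact_integrable; first exact: segment_compact.
  exact: continuous_subspaceT.
pose f (x : R) := (\int[lebesgue_measure]_(t in `[a - 1, x]) s t)%R.
have f0 x : x <= a -> f x = 0.
  move=> xa; rewrite /f /Rintegral integral0_eq //= => t.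
  by rewrite in_itv /= => /andP[_ tx]; rewrite s0 // (le_trans tx).
exists f; split => // x.
have [xa|ax] := ltP x a.
  apply: (@near_eq_is_derive _ _ _ (cst 0)).
  - near=> y; rewrite f0 // ltW //; near: y; exact: lt_nbhsl.
  - rewrite s0 ?ltW //; exact: is_derive_cst.
have [] := @continuous_FTC1_closed _ s (a - 1) x (x + 1) _ (int _ _) _ (cs x); [lra|lra|].
by move=> df f'; split => //; rewrite -derive1E.
Unshelve. all: by end_near. Qed.

(** As a function of the step [x], the second difference minus [k * x ^+ 2] has
    derivative 0 on [0, h]. *)
Lemma second_difference (R : realType) (f f' : R -> R) (k s h : R) :
    (forall x : R, is_derive x 1 f (f' x)) -> 0 < h ->
    (forall x y : R, s - h < x -> x <= y -> y < s + h -> f' y - f' x = k * (y - x)) ->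
  f (s + h) + f (s - h) - f s *+ 2 = k * h ^+ 2.
Proof.
move=> df h0 f'L.
pose g (x : R) := f (s + x) + f (s - x) - k * x ^+ 2.
have dg (x : R) : is_derive x 1 g (f' (s + x) - f' (s - x) - k * (x *+ 2)).
  have -> : g = (f \o (fun x => s + x)) + (f \o (fun x => s - x)) - k *: (id ^+ 2).
    by apply/funext => y; rewrite /g.
  apply: is_derive_eq.
  by rewrite /GRing.scale /=; ring.
have cg : {within `[0, h], continuous g}.
  apply: continuous_subspaceT => x; apply: differentiable_continuous.
  by apply/derivable1_diffP; apply: (@ex_derive _ _ _ _ _ _ _ (dg x)).
have [c + ] := @MVT _ g _ 0 h h0 (fun x _ => dg x) cg.
rewrite in_itv /= => /andP[c0 ch]; rewrite f'L; try lra.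
rewrite /g subr0 !addr0 expr0n /= mulr0 subr0 => E.
have {}E : f (s + h) + f (s - h) - k * h ^+ 2 - (f s + f s) = 0 by rewrite E; ring.
by rewrite mulr2n; lra.
Qed.

Lemma MVT_le (R : realType) (f f' : R -> R) (c d : R) :
    (forall x : R, is_derive x 1 f (f' x)) ->
  forall x y : R, x <= y -> (forall z, x <= z <= y -> c <= f' z <= d) ->
  c * (y - x) <= f y - f x <= d * (y - x).
Proof.
move=> df x y; rewrite le_eqVlt => /predU1P[->|xy] cd.
  by rewrite !subrr !mulr0 lexx.
have cf : {within `[x, y], continuous f}.
  apply: continuous_subspaceT => z; apply: differentiable_continuous.
  by apply/derivable1_diffP; apply: (@ex_derive _ _ _ _ _ _ _ (df z)).
have [z + ->] := @MVT _ f f' x y xy (fun x _ => df x) cf.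
rewrite in_itv /= => /andP[xz zy].
have /andP[c1 c2] : c <= f' z <= d by apply: cd; rewrite !ltW.
by rewrite !ler_wpM2r // subr_ge0 ltW.
Qed.

Lemma convex_tangent (R : realType) (f f' : R -> R) :
    (forall x : R, is_derive x 1 f (f' x)) ->
    (forall x y : R, x <= y -> f' x <= f' y) ->
  forall x y : R, f x + f' x * (y - x) <= f y.
Proof.
move=> df mf x y.
have cf a b : {within `[a, b], continuous f}.
  apply: continuous_subspaceT => z; apply: differentiable_continuous.
  by apply/derivable1_diffP; apply: (@ex_derive _ _ _ _ _ _ _ (df z)).
have [xy|yx|<-] := ltgtP x y; last by rewrite subrr mulr0 addr0.
  have [z + E] := @MVT _ f f' x y xy (fun x _ => df x) (cf _ _).
  rewrite in_itv /= => /andP[xz zy].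
  have := mf _ _ (ltW xz); nra.
have [z + E] := @MVT _ f f' y x yx (fun x _ => df x) (cf _ _).
rewrite in_itv /= => /andP[yz zx].
have := mf _ _ (ltW zx); nra.
Qed.

(** The bound [1/20] on the derivative keeps [f] below [1/4] on the body. The
    factor 4 in [f'], i.e. second derivative 4 on a dense set, beats the second
    derivative 2 of the square of the distance along the first axis, whence the
    last inequality. *)
Lemma densely_curved (R : realType) : exists f f' : R -> R,
  [/\ (forall x : R, is_derive x 1 f (f' x)),
      (forall x y : R, x <= y -> 0 <= f' y - f' x <= 4 * (y - x)),
      (forall x : R, x <= -2 -> f x = 0),
      (forall x : R, 0 <= f' x <= 1/20) &
      (forall x : R, 2 <= x -> f x = f 2 + f' 2 * (x - 2)) /\
      (forall a b : R, -2 <= a -> a < b -> b <= 2 -> exists s h : R,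
        [/\ a < s < b, 0 < h, -2 <= s - h, s + h <= 2 &
          2 * h ^+ 2 < f (s + h) + f (s - h) - f s *+ 2])].
Proof.
have [|V [oV V2 Ve dV]] := @small_dense_open R (1/80); first lra.
have [s [sL sV se s0 s2]] := distribution_function oV V2 Ve.
pose f' x := 4 * s x.
have f'L x y : x <= y -> 0 <= f' y - f' x <= 4 * (y - x).
  by move=> /sL; rewrite /f'; lra.
have f'0 x : x <= -2 -> f' x = 0 by move=> /s0; rewrite /f' => ->; rewrite mulr0.
have [f [df f0]] := lipschitz_antiderivative f'L f'0.
exists f, f'; split => //.
- by move=> x; have := se x; rewrite /f'; lra.
split.
- move=> x x2.
  have := MVT_le df x2 (c := f' 2) (d := f' 2).
  have cd z : 2 <= z <= x -> f' 2 <= f' z <= f' 2.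
    by move=> /andP[/s2 z2 _]; rewrite /f' z2 lexx.
  by move=> /(_ cd); lra.
- move=> a b a2 ab b2; have [t [h [atb h0 hV]]] := dV a b a2 ab b2.
  have hV' x : t - h < x -> x < t + h -> -2 < x < 2.
    by move=> x1 x2; have /= := V2 x; rewrite in_itv; apply; apply: hV; rewrite /= in_itv /= x1 x2.
  have e0 : 0 < h / 2 by lra.
  have := hV' (t - h / 2); have := hV' (t + h / 2).
  move=> h1 h2.
  exists t, (h / 2); split => //.
  + have : -2 < t - h / 2 < 2 by apply: h2; lra.
    lra.
  + have : -2 < t + h / 2 < 2 by apply: h1; lra.
    lra.
  + have -> := @second_difference _ f f' 4 t (h / 2) df e0.
      have : 0 < (h / 2) ^+ 2 by rewrite exprn_gt0.
      lra.
    move=> x y tx xy yt; rewrite /f' -mulrBr sV // => z /=.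
    rewrite in_itv /= => /andP[xz zy]; apply: hV; rewrite /= in_itv /=.
    by apply/andP; split; lra.
Qed.

(** * Euclidean geometry of row vectors *)

Definition dotp (R : realType) (n : nat) (u v : 'rV[R]_n) : R :=
  \sum_(i < n) u 0 i * v 0 i.

Section euclidean.
Variables (R : realType) (n : nat).
Implicit Types (u v w x y : 'rV[R]_n) (a b : R).

Lemma dotpC u v : dotp u v = dotp v u.
Proof. by apply: eq_bigr => i _; rewrite mulrC. Qed.

Lemma dotpDl u v w : dotp (u + v) w = dotp u w + dotp v w.
Proof. by rewrite /dotp -big_split; apply: eq_bigr => i _; rewrite mxE mulrDl. Qed.

Lemma dotpZl a u w : dotp (a *: u) w = a * dotp u w.
Proof. by rewrite /dotp mulr_sumr; apply: eq_bigr => i _; rewrite mxE mulrA. Qed.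

Lemma dotpNl u w : dotp (- u) w = - dotp u w.
Proof. by rewrite -scaleN1r dotpZl mulN1r. Qed.

Lemma dotpBl u v w : dotp (u - v) w = dotp u w - dotp v w.
Proof. by rewrite dotpDl dotpNl. Qed.

Lemma dotpDr u v w : dotp w (u + v) = dotp w u + dotp w v.
Proof. by rewrite dotpC dotpDl !(dotpC w). Qed.

Lemma dotpZr a u w : dotp w (a *: u) = a * dotp w u.
Proof. by rewrite dotpC dotpZl (dotpC w). Qed.

Lemma dotpNr u w : dotp w (- u) = - dotp w u.
Proof. by rewrite dotpC dotpNl (dotpC w). Qed.

Lemma dotpBr u v w : dotp w (u - v) = dotp w u - dotp w v.
Proof. by rewrite dotpDr dotpNr. Qed.

Lemma enorm_ge0 u : 0 <= enorm u. Proof. exact: sqrtr_ge0. Qed.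

Lemma sqr_enorm u : enorm u ^+ 2 = dotp u u.
Proof.
rewrite sqr_sqrtr; first by apply: eq_bigr => i _; rewrite expr2.
by apply: sumr_ge0 => i _; exact: sqr_ge0.
Qed.

Lemma dotp_ge0 u : 0 <= dotp u u.
Proof. by rewrite -sqr_enorm exprn_ge0 ?enorm_ge0. Qed.

Lemma ler_sqr_enorm u a : 0 <= a -> (enorm u <= a) = (dotp u u <= a ^+ 2).
Proof. by move=> a0; rewrite -sqr_enorm ler_sqr ?nnegrE ?enorm_ge0. Qed.

Lemma enormZ a u : enorm (a *: u) = `|a| * enorm u.
Proof.
apply/eqP; rewrite -(@eqrXn2 _ 2) ?mulr_ge0 ?enorm_ge0 //.
by rewrite exprMn !sqr_enorm dotpZl dotpZr real_normK ?num_real // mulrA.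
Qed.

Lemma enormN u : enorm (- u) = enorm u.
Proof. by rewrite -scaleN1r enormZ normrN1 mul1r. Qed.

Lemma enormBC u v : enorm (u - v) = enorm (v - u).
Proof. by rewrite -opprB enormN. Qed.

Lemma enorm_eq0 u : enorm u = 0 -> u = 0.
Proof.
move=> u0; have : dotp u u = 0 by rewrite -sqr_enorm u0 expr0n.
move/eqP; rewrite psumr_eq0 => [/allP uu|i _]; last by rewrite -expr2 sqr_ge0.
apply/rowP => i; rewrite mxE; apply/eqP.
by have := uu i (mem_index_enum i); rewrite /= -expr2 sqrf_eq0.
Qed.

Lemma enorm0 : enorm (0 : 'rV[R]_n) = 0.
Proof. by rewrite -(scale0r (0 : 'rV[R]_n)) enormZ normr0 mul0r. Qed.

Lemma cauchy_schwarz u v : dotp u v <= enorm u * enorm v.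
Proof.
have [->|v0] := eqVneq v 0.
  by rewrite enorm0 mulr0 -(scale0r (0 : 'rV[R]_n)) dotpZr mul0r.
have [->|u0] := eqVneq u 0.
  by rewrite enorm0 mul0r -(scale0r (0 : 'rV[R]_n)) dotpZl mul0r.
have nz w : w != 0 -> 0 < enorm w.
  by move=> w0; rewrite lt_neqAle enorm_ge0 andbT eq_sym; apply: contra w0 => /eqP/enorm_eq0 ->.
have := dotp_ge0 (enorm v *: u - enorm u *: v).
rewrite dotpBl !dotpBr !dotpZl !dotpZr -!sqr_enorm (dotpC v u).
have [nv nu] := (nz _ v0, nz _ u0).
have p0 : 0 < enorm v * enorm u by rewrite mulr_gt0.
move=> H; rewrite -subr_ge0 -(pmulr_rge0 _ p0).
nra.
Qed.

Lemma enormD u v : enorm (u + v) <= enorm u + enorm v.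
Proof.
rewrite ler_sqr_enorm ?addr_ge0 ?enorm_ge0 //.
rewrite dotpDl !dotpDr -!sqr_enorm (dotpC v u).
have := cauchy_schwarz u v; nra.
Qed.

Lemma enorm_triangle x y z : enorm (x - z) <= enorm (x - y) + enorm (y - z).
Proof. by apply: le_trans (enormD _ _); rewrite addrA subrK. Qed.

Lemma coord_le_norm u i : `|u 0 i| <= `|u|.
Proof.
rewrite [leRHS]mx_normrE.
exact: (@le_bigmax _ _ _ _ (fun ij : 'I_1 * 'I_n => `|u ij.1 ij.2|) (0, i)).
Qed.

Lemma enorm_le_norm u : enorm u <= n.+1%:R * `|u|.
Proof.
rewrite ler_sqr_enorm ?mulr_ge0 //.
apply: (@le_trans _ _ (\sum_(i < n) `|u| ^+ 2)).
  apply: ler_sum => i _; rewrite -expr2 -real_normK ?num_real //.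
  by rewrite ler_sqr ?nnegrE // coord_le_norm.
rewrite sumr_const card_ord -[leLHS]mulr_natl exprMn ler_wpM2r ?sqr_ge0 //.
rewrite -natrX ler_nat; apply: (@leq_trans n.+1) => //.
by rewrite -[leqLHS]expn1 leq_pexp2l.
Qed.

(** The topology is that of the sup norm, hence the comparison with
    [enorm_le_norm]. *)
Lemma enorm_lipschitz_continuous (f : 'rV[R]_n -> R) :
  (forall x y, f x - f y <= enorm (x - y)) -> continuous f.
Proof.
move=> fL x; apply/(@cvgrPdist_le _ _ _ (nbhs x) (nbhs_filter x)) => e e0.
have k0 : 0 < n.+1%:R :> R by rewrite ltr0n.
near=> y.
have xy : `|x - y| <= e / n.+1%:R.
  near: y; apply: cvgr_dist_le; [exact: cvg_id|exact: divr_gt0].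
apply: (@le_trans _ _ (enorm (x - y))).
  have := fL x y; have := fL y x.
  by rewrite (enormBC y) ler_norml => T1 T2; apply/andP; split; lra.
by apply: (le_trans (enorm_le_norm _)); rewrite mulrC -ler_pdivlMr.
Unshelve. all: by end_near. Qed.

End euclidean.

Section directional.
Variables (R : realType) (n : nat).
Implicit Types (f : 'rV[R]_n -> R) (x v : 'rV[R]_n).

(** The growth of [f] has to be controlled only on one side of [x] and for small
    [t]: this is what touching functions and nearest points provide. *)
Lemma derive_le f x v (c e : R) : derivable f x v -> 0 < e ->
  (forall t, 0 < t -> t < e -> f (x + t *: v) - f x <= c * t) -> 'D_v f x <= c.
Proof.
move=> df e0 fc; rewrite leNgt; apply/negP => cD.
have := df; rewrite /derivable => /cvg_ex[l Hl].
have E : 'D_v f x = l by apply/cvg_lim.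
move: Hl; rewrite -E => /cvgrPdist_lt/(_ ('D_v f x - c)); rewrite subr_gt0.
move=> /(_ cD); rewrite near_withinE -nbhs_ballE => -[d /= d0 H].
pose t := Num.min d e / 2.
have [t0 td te] : [/\ 0 < t, t < d & t < e].
  by rewrite /t; case: (leP d e) => ?; split; lra.
have := H t; rewrite /ball /= sub0r normrN gtr0_norm // => /(_ td).
rewrite gt_eqF // => /(_ isT); rewrite ltr_norml => /andP[_].
rewrite /= (addrC _ x) [_ *: _]mulrC => H1.
have := fc t t0 te; rewrite -ler_pdivrMr //; lra.
Qed.

Lemma derive_gradient f x v : differentiable f x ->
  'D_v f x = dotp v (gradient f x).
Proof.
move=> df; rewrite deriveE // {1}(row_sum_delta v) linear_sum /=.
by apply: eq_bigr => i _; rewrite linearZ /= mxE deriveE.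
Qed.

Lemma near_ray (P : 'rV[R]_n -> Prop) x v : (\forall y \near x, P y) ->
  exists2 e : R, 0 < e & forall t, 0 < t -> t < e -> P (x + t *: v).
Proof.
move=> /nbhs_ballP[d /= d0 dP].
have k0 : 0 < `|v| + 1 by rewrite ltr_wpDl.
exists (d / (`|v| + 1)) => [|t t0 td]; first exact: divr_gt0.
apply: dP; rewrite -ball_normE /= opprD addNKr normrN normrZ gtr0_norm //.
move: td; rewrite ltr_pdivlMr // => td; apply: le_lt_trans td.
by rewrite ler_pM2l // lerDl.
Qed.

End directional.

(** * The distance to a compact set *)

Section distance.
Variables (R : realType) (n : nat) (K : set 'rV[R]_n).
Hypotheses (cK : compact K) (K0 : K !=set0).
Implicit Types x y a b : 'rV[R]_n.

Lemma nearest x : exists2 a, K a & forall b, K b -> enorm (x - a) <= enorm (x - b).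
Proof.
have cf : {within K, continuous (fun a => enorm (x - a))}.
  apply: continuous_subspaceT; apply: enorm_lipschitz_continuous => a b.
  have := enormD (x - b) (b - a); rewrite addrA subrK (enormBC b); lra.
have [a aK ha] := compact_EVT_min K0 cK cf.
by exists a => [|b bK]; [exact: set_mem|apply/ha/mem_set].
Qed.

Lemma dist_nearest x a : K a -> (forall b, K b -> enorm (x - a) <= enorm (x - b)) ->
  dist K x = enorm (x - a).
Proof.
move=> Ka aP; apply/eqP; rewrite eq_le; apply/andP; split.
  apply: ge_inf; last by exists a.
  by exists 0 => _ [b _ <-]; exact: enorm_ge0.
apply: lb_le_inf; first by exists (enorm (x - a)), a.
by move=> _ [b Kb <-]; exact: aP.
Qed.

Lemma dist_attained x : exists2 a, K a & dist K x = enorm (x - a).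
Proof. by have [a Ka aP] := nearest x; exists a => //; exact: dist_nearest. Qed.

Lemma dist_le x a : K a -> dist K x <= enorm (x - a).
Proof. by have [b Kb bP] := nearest x => Ka; rewrite (dist_nearest Kb bP) bP. Qed.

Lemma dist_ge0 x : 0 <= dist K x.
Proof. by have [a _ ->] := dist_attained x; exact: enorm_ge0. Qed.

Lemma dist_lipschitz x y : dist K x - dist K y <= enorm (x - y).
Proof.
have [a Ka ->] := dist_attained y; rewrite lerBlDr.
exact: le_trans (dist_le _ Ka) (enorm_triangle _ _ _).
Qed.

(** Towards a nearest point the distance decreases with unit speed. If it is
    differentiable, it decreases with speed [2 * r] along the sum of the two
    vectors of length [r] that lead to [a] and to [b]; being 1-Lipschitz, it
    forces this sum to have length [2 * r], so the two vectors are equal. The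
    lemma concerns a function [f] that agrees with the distance near [x] so as
    to apply to the signed distance as well. *)
Lemma differentiable_dist_unique (f : 'rV[R]_n -> R) x a b :
  (\forall y \near x, f y = dist K y) -> differentiable f x ->
  K a -> K b -> dist K x = enorm (x - a) -> dist K x = enorm (x - b) -> a = b.
Proof.
move=> fK df Ka Kb xa xb; set r := dist K x.
have fx : f x = dist K x by exact: nbhs_singleton fK.
have slope c : K c -> dist K x = enorm (x - c) -> dotp (c - x) (gradient f x) <= - r.
  move=> Kc xc; rewrite -derive_gradient //.
  have [e e0 fe] := near_ray (c - x) fK.
  apply: (@derive_le _ _ _ _ _ _ (Num.min e 1)).
  - exact: diff_derivable.
  - by rewrite lt_min e0 ltr01.
  move=> t t0; rewrite lt_min => /andP[te t1]; have := dist_le (x + t *: (c - x)) Kc.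
  have -> : x + t *: (c - x) - c = (1 - t) *: (x - c).
    by apply/rowP => i; rewrite !mxE; ring.
  rewrite fe // fx enormZ gtr0_norm ?subr_gt0 // -xc /r; lra.
have := slope a Ka xa; have := slope b Kb xb; move=> sb sa.
set v := (x - a) + (x - b).
have vr : 2 * r <= enorm v.
  have : dotp v (gradient f x) <= enorm v.
    rewrite -derive_gradient //; have [e e0 fe] := near_ray v fK.
    apply: (@derive_le _ _ _ _ _ _ e) => //.
      exact: diff_derivable.
    move=> t t0 te; have := dist_lipschitz (x + t *: v) x.
    by rewrite fe // fx [x + _]addrC addrK enormZ gtr0_norm // mulrC.
  rewrite dotpDl -!(opprB _ x) !dotpNl; lra.
have : enorm (a - b) = 0.
  apply/eqP; rewrite -sqrf_eq0 eq_le sqr_ge0 andbT.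
  have : enorm (a - b) ^+ 2 + enorm v ^+ 2 = 2 * r ^+ 2 + 2 * r ^+ 2.
    rewrite {1}/r {1}xa {1}/r xb !sqr_enorm.
    have -> : a - b = (x - b) - (x - a) by apply/rowP => i; rewrite !mxE; ring.
    rewrite /v; move: (x - a) (x - b) => p q.
    by rewrite !(dotpDl, dotpDr, dotpNl, dotpNr) (dotpC q p); ring.
  have r0 : 0 <= r by exact: dist_ge0.
  nra.
by move/enorm_eq0/eqP; rewrite subr_eq0 => /eqP.
Qed.

End distance.

(** * The signed distance to the boundary of a convex sublevel set *)

Definition sublevel (R : realType) (n : nat) (G : 'rV[R]_n -> R) : set 'rV[R]_n :=
  [set x | G x <= 1].

Section sublevel_body.
Variables (R : realType) (n : nat) (G : 'rV[R]_n -> R).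
Hypotheses (cG : continuous G) (G0 : G 0 < 1) (cC : compact (sublevel G)).
Hypothesis subgradient :
  forall a, exists w, forall y, G a + dotp (y - a) w <= G y.
Hypothesis levelset0 : [set x | G x = 1] !=set0.
Let C := sublevel G.
Implicit Types x y a b v : 'rV[R]_n.

Lemma sublevel_segment x y t : 0 <= t <= 1 -> C x -> C y -> C (x + t *: (y - x)).
Proof.
move=> t01; rewrite /C /sublevel /= => Gx Gy; set z := x + _.
have [w wP] := subgradient z.
have := wP x; have := wP y.
have -> : y - z = (1 - t) *: (y - x) by apply/rowP => i; rewrite !mxE; ring.
have -> : x - z = - t *: (y - x) by apply/rowP => i; rewrite !mxE; ring.
rewrite !dotpZl; nra.
Qed.

Lemma sublevel_convex : convex_set (C : set (convex_lmodType 'rV[R]_n)).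
Proof.
move=> x y l /set_mem Cx /set_mem Cy; apply/mem_set.
have := @sublevel_segment y x l%:num _ Cy Cx; rewrite ge0 le1 => /(_ isT).
congr (C _).
by apply/rowP => i; rewrite /conv /= !mxE /unstable.onem; ring.
Qed.

Lemma closed_sublevel : closed C.
Proof.
by apply: (@closed_comp _ _ G [set r | r <= 1]) => [x _|]; [exact: cG|exact: closed_le].
Qed.

Lemma sublevel_interior x : G x < 1 -> C° x.
Proof.
move=> Gx; have : open (G @^-1` [set r | r < 1]).
  by apply: open_comp => [y _|]; [exact: cG|exact: open_lt].
move=> oU; have /open_nbhs_nbhs := conj oU Gx.
by apply: filterS => y /ltW.
Qed.

(** A subgradient [w] of [G] at a point [x] of the level set satisfies
    [0 < dotp x w] because [G 0 < 1], so [G] exceeds 1 at points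
    [x + t *: x] arbitrarily close to [x]. *)
Lemma boundary_sublevel : boundary C = [set x | G x = 1].
Proof.
rewrite /boundary; have /closure_id <- := closed_sublevel.
apply/seteqP; split => x /=.
  move=> [Cx nCx]; apply/eqP; rewrite eq_le Cx leNgt.
  by apply/negP => /sublevel_interior.
move=> Gx; split; first by rewrite /C /sublevel /= Gx.
move=> /(near_ray x)[e e0 eC].
have [w wP] := subgradient x.
have H1 : G (x + (e / 2) *: x) <= 1 by apply: eC; lra.
have H2 := wP (x + (e / 2) *: x); have := wP 0.
rewrite [x + _ - x]addrC addKr dotpZl Gx in H2.
rewrite sub0r dotpNl Gx => H3.
have d0 : 0 < dotp x w by have := le_lt_trans H3 G0; lra.
have : 0 < e / 2 * dotp x w by rewrite mulr_gt0 // divr_gt0.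
lra.
Qed.

Lemma sublevel_crossing x y : G x <= 1 -> 1 <= G y ->
  exists2 z, G z = 1 & enorm (x - z) + enorm (z - y) = enorm (x - y).
Proof.
move=> Gx Gy.
pose p t := x + t *: (y - x).
have cp : continuous p.
  move=> t; apply: cvgD; first exact: cvg_cst.
  by apply: cvgZr_tmp; exact: cvg_id.
have cg : {within `[0, 1], continuous (G \o p)}.
  by apply: continuous_subspaceT => t; apply: continuous_comp; [exact: cp|exact: cG].
have [|t t01 Gt] := @IVT _ (G \o p) 0 1 1 ler01 cg.
  rewrite /p /= scale0r scale1r addr0 (addrC x) subrK.
  by rewrite ge_min Gx le_max Gy orbT.
move: t01; rewrite in_itv /= => /andP[t0 t1].
exists (p t); first exact: Gt.
have -> : x - p t = t *: (x - y) by apply/rowP => i; rewrite !mxE; ring.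
have -> : p t - y = (1 - t) *: (x - y) by apply/rowP => i; rewrite !mxE; ring.
rewrite !enormZ !ger0_norm ?subr_ge0 //; ring.
Qed.

Let K := [set x | G x = 1].

Lemma compact_levelset : compact K.
Proof.
apply: (subclosed_compact _ cC); last by move=> x /= Gx; rewrite /sublevel /= Gx.
by apply: (@closed_comp _ _ G [set r | r = 1]) => [x _|]; [exact: cG|exact: closed_eq].
Qed.

(** On the boundary a subgradient is an outer normal. Outside, [v] leads from a
    nearest boundary point [a] to [x]; a point [y] of [C] with
    [0 < dotp (y - a) v] would make [a + s *: (y - a)], which is in [C], closer
    to [x] than [a] for small [s]. *)
Lemma outer_normal x : 1 <= G x ->
  exists a v, [/\ enorm v = 1, x = a + dist K x *: v, K a &
    forall y, C y -> dotp (y - a) v <= 0].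
Proof.
rewrite le_eqVlt => /predU1P[Gx|Gx].
  have [w wP] := subgradient x.
  have nw : 0 < enorm w.
    rewrite lt_neqAle enorm_ge0 andbT eq_sym; apply/eqP => /enorm_eq0 w0.
    have := wP 0; rewrite w0 -[X in dotp _ X](scale0r (0 : 'rV[R]_n)) dotpZr mul0r addr0 -Gx.
    by rewrite leNgt G0.
  exists x, ((enorm w)^-1 *: w); split => //.
  - by rewrite enormZ gtr0_norm ?invr_gt0 // mulVf // gt_eqF.
  - have Kx : K x by [].
    have -> : dist K x = 0; last by rewrite scale0r addr0.
    apply/eqP; rewrite eq_le (dist_ge0 compact_levelset levelset0) andbT.
    by have := dist_le compact_levelset levelset0 x Kx; rewrite subrr enorm0.
  - move=> y; rewrite /C /sublevel /= => Gy; rewrite dotpZr pmulr_rle0 ?invr_gt0 //.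
    have := wP y; lra.
have [a Ka xa] := dist_attained compact_levelset levelset0 x.
set r := dist K x in xa *.
have r0 : 0 < r.
  rewrite xa lt_neqAle enorm_ge0 andbT eq_sym; apply/eqP => /enorm_eq0/eqP.
  by rewrite subr_eq0 => /eqP E; move: Gx; rewrite E Ka ltxx.
have Ca : C a by rewrite /C /sublevel /= Ka.
exists a, (r^-1 *: (x - a)); split => //.
- by rewrite enormZ gtr0_norm ?invr_gt0 // -xa mulVf // gt_eqF.
- by rewrite scalerA divff ?gt_eqF // scale1r addrC subrK.
move=> y Cy; rewrite dotpZr pmulr_rle0 ?invr_gt0 //.
rewrite leNgt; apply/negP => D0.
set N := dotp (y - a) (y - a).
have N0 : 0 <= N by exact: dotp_ge0.
set D := dotp _ _ in D0.
(* This s is at most 1 and satisfies s * N < 2 * D, which makes the squared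
   distance r^2 - 2 * s * D + s^2 * N smaller than r^2. *)
pose s := D / (N + D).
have ND : 0 < N + D by rewrite ltr_wpDl.
have sE : s * (N + D) = D by rewrite divfK // gt_eqF.
have s0 : 0 < s by rewrite divr_gt0.
have s1 : s <= 1 by rewrite ler_pdivrMr // mul1r lerDr.
have Cz : C (a + s *: (y - a)) by apply: sublevel_segment; rewrite ?(ltW s0).
have [b Kb bE] := sublevel_crossing Cz (ltW Gx).
have : r <= enorm (x - (a + s *: (y - a))).
  have := dist_le compact_levelset levelset0 x Kb; rewrite -/r.
  have := enorm_ge0 (a + s *: (y - a) - b).
  rewrite (enormBC x b) (enormBC x (_ + _)); lra.
have -> : x - (a + s *: (y - a)) = (x - a) - s *: (y - a).
  by apply/rowP => i; rewrite !mxE; ring.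
rewrite -ler_sqr ?nnegrE ?enorm_ge0 ?(ltW r0) // xa !sqr_enorm.
have expand (p q : 'rV[R]_n) : dotp (p - s *: q) (p - s *: q) =
    dotp p p - 2 * s * dotp q p + s ^+ 2 * dotp q q.
  by rewrite !(dotpDl, dotpDr, dotpNl, dotpNr, dotpZl, dotpZr) (dotpC p q); ring.
rewrite expand -/N -/D => H.
have : 0 <= s * (s * N - 2 * D) by lra.
rewrite pmulr_rge0 //; nra.
Qed.

Lemma signed_dist_in x : G x <= 1 -> signed_dist C x = dist K x.
Proof. by move=> Gx; rewrite /signed_dist boundary_sublevel mem_set. Qed.

Lemma signed_dist_out x : 1 <= G x -> signed_dist C x = - dist K x.
Proof.
rewrite le_eqVlt => /predU1P[Gx|Gx].
  rewrite signed_dist_in -?Gx //; have := dist_le compact_levelset levelset0 x (esym Gx).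
  rewrite subrr enorm0 => r0; have := dist_ge0 compact_levelset levelset0 x => r0'.
  have -> : dist K x = 0 by apply/eqP; rewrite eq_le r0 r0'.
  by rewrite oppr0.
rewrite /signed_dist boundary_sublevel memNset // /C /sublevel /=.
by apply/negP; rewrite -ltNge.
Qed.

(** Between a point of [C] and a point outside, the segment meets the boundary,
    and the two distances to the crossing point add up. *)
Lemma signed_dist_lipschitz x y :
  signed_dist C x - signed_dist C y <= enorm (x - y).
Proof.
have [[Lxy Lyx] [dx dy]] := ((dist_lipschitz compact_levelset levelset0 x y,
  dist_lipschitz compact_levelset levelset0 y x),
  (dist_ge0 compact_levelset levelset0 x, dist_ge0 compact_levelset levelset0 y)).
rewrite (enormBC y) in Lyx.
have [Gx|Gx] := leP (G x) 1; have [Gy|Gy] := leP (G y) 1.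
- by rewrite !signed_dist_in.
- have [z Gz <-] := sublevel_crossing Gx (ltW Gy).
  rewrite (signed_dist_in Gx) (signed_dist_out (ltW Gy)).
  have := dist_le compact_levelset levelset0 x Gz; have := dist_le compact_levelset levelset0 y Gz.
  by rewrite (enormBC y); lra.
- rewrite (signed_dist_out (ltW Gx)) (signed_dist_in Gy).
  by have := enorm_ge0 (x - y); lra.
- by rewrite (signed_dist_out (ltW Gx)) (signed_dist_out (ltW Gy)); lra.
Qed.

(** Inside, [v] leads to a nearest boundary point [a]. Elsewhere [v] is an outer
    normal, and the supporting half-space shows that moving along [v] increases
    the distance to [C] at full speed. *)
Lemma signed_dist_descent x : exists v, enorm v = 1 /\
  exists2 e, 0 < e & forall t, 0 < t -> t < e ->
    signed_dist C (x + t *: v) <= signed_dist C x - t.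
Proof.
have [Gx|Gx] := ltP (G x) 1.
  have [a Ka xa] := dist_attained compact_levelset levelset0 x.
  set r := dist K x in xa *.
  have r0 : 0 < r.
    rewrite xa lt_neqAle enorm_ge0 andbT eq_sym; apply/eqP => /enorm_eq0/eqP.
    by rewrite subr_eq0 => /eqP E; move: Gx; rewrite E Ka ltxx.
  exists (r^-1 *: (a - x)); split.
    by rewrite enormZ gtr0_norm ?invr_gt0 // enormBC -xa mulVf // gt_eqF.
  exists r => // t t0 tr; rewrite (signed_dist_in (ltW Gx)) -/r.
  set p := x + _.
  have pa : enorm (p - a) = r - t.
    have -> : p - a = (1 - t / r) *: (x - a).
      by apply/rowP => i; rewrite !mxE; ring.
    rewrite enormZ -xa ger0_norm; last by rewrite subr_ge0 ler_pdivrMr ?mul1r ?ltW.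
    by rewrite mulrBl mul1r divfK // gt_eqF.
  have dp := dist_le compact_levelset levelset0 p Ka.
  have dp0 := dist_ge0 compact_levelset levelset0 p.
  have [Gp|Gp] := leP (G p) 1; first by rewrite signed_dist_in // -pa.
  by rewrite (signed_dist_out (ltW Gp)); lra.
have [a [v [v1 xav Ka Cv]]] := outer_normal Gx.
exists v; split=> //; exists 1 => // t t0 t1.
rewrite (signed_dist_out Gx); set p := x + _; set r := dist K x in xav *.
have r0 : 0 <= r by exact: (dist_ge0 compact_levelset levelset0).
have vv : dotp v v = 1 by rewrite -sqr_enorm v1 expr1n.
have pav : dotp (p - a) v = r + t.
  have -> : p - a = (r + t) *: v.
    by apply/rowP => i; rewrite /p xav !mxE; ring.
  by rewrite dotpZl vv mulr1.
have Gp : 1 <= G p.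
  rewrite leNgt; apply/negP => Gp.
  have := Cv p (ltW Gp); rewrite pav; lra.
rewrite signed_dist_out //; have [b Kb ->] := dist_attained compact_levelset levelset0 p.
have Cb : C b by rewrite /C /sublevel /= Kb.
have := Cv b Cb; have := cauchy_schwarz (p - b) v.
have -> : p - b = (p - a) - (b - a) by apply/rowP => i; rewrite !mxE; ring.
rewrite dotpBl pav v1; lra.
Qed.

(** The test function inherits the 1-Lipschitz bound along the opposite of its
    gradient in the first case, and the unit speed of descent in the second. *)
Lemma signed_dist_eikonal : eikonal_viscosity_solution setT (signed_dist C).
Proof.
split.
  apply: continuous_subspaceT.
  exact: enorm_lipschitz_continuous signed_dist_lipschitz.
move=> x phi _ /nbhs_singleton[dphi _]; set g := gradient phi x.
split => H.
  have [e e0 eP] := near_ray (- g) H.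
  have D : 'D_(- g) (- phi) x <= enorm g.
    apply: (@derive_le _ _ _ _ _ _ e) => //.
      by apply: diff_derivable; exact: differentiableN.
    move=> t t0 te; have := eP t t0 te.
    have := signed_dist_lipschitz x (x + t *: - g).
    rewrite opprD addNKr enormN enormZ enormN gtr0_norm // fctE /=; lra.
  move: D; rewrite deriveN; last exact: diff_derivable.
  rewrite derive_gradient // dotpNl opprK -sqr_enorm -/g => D.
  have := enorm_ge0 g; nra.
have [v [v1 [d d0 dP]]] := signed_dist_descent x.
have [e e0 eP] := near_ray v H.
have D : 'D_v phi x <= -1.
  apply: (@derive_le _ _ _ _ _ _ (Num.min d e)) => //.
  - exact: diff_derivable.
  - by rewrite lt_min d0.
  move=> t t0; rewrite lt_min => /andP[td te].
  have := eP t t0 te; have := dP t t0 td; lra.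
have := cauchy_schwarz (- v) g; rewrite enormN v1 mul1r dotpNl.
rewrite -derive_gradient // => D'.
have := enorm_ge0 g; nra.
Qed.

End sublevel_body.

(** * Locally Lipschitz maps *)

Definition loc_lip (R : realType) (V W : normedModType R) (f : V -> W) (x : V) : Prop :=
  exists k, exists2 A, nbhs x A &
    forall y z, A y -> A z -> `|f y - f z| <= k * `|y - z|.

Section locally_lipschitz.
Variable R : realType.

Lemma loc_lip_continuous (V W : normedModType R) (f : V -> W) x :
  loc_lip f x -> {for x, continuous f}.
Proof.
move=> [k [A xA fk]]; apply/(@cvgrPdist_le _ _ _ (nbhs x) (nbhs_filter x)) => e e0.
have k0 : 0 < `|k| + 1 by rewrite ltr_wpDl.
have Ax : A x by exact: nbhs_singleton.
near=> y.
have Ay : A y by near: y.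
apply: (le_trans (fk _ _ Ax Ay)).
apply: (@le_trans _ _ ((`|k| + 1) * `|x - y|)).
  by apply: ler_wpM2r => //; have := ler_norm k; lra.
rewrite mulrC -ler_pdivlMr //.
near: y; apply: cvgr_dist_le; [exact: cvg_id|exact: divr_gt0].
Unshelve. all: by end_near. Qed.

Lemma loc_lip_near (V W : normedModType R) (f g : V -> W) x :
  (\forall y \near x, f y = g y) -> loc_lip f x -> loc_lip g x.
Proof.
move=> fg [k [A xA fk]]; exists k, (A `&` [set y | f y = g y]).
  by apply: filterI.
by move=> y z [Ay /= <-] [Az /= <-]; exact: fk.
Qed.

Lemma lip_loc_lip (V W : normedModType R) (f : V -> W) x k :
  (forall y z, `|f y - f z| <= k * `|y - z|) -> loc_lip f x.
Proof. by move=> fk; exists k, setT => [|y z _ _]; [exact: filterT|exact: fk]. Qed.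

Lemma loc_lip_cst (V W : normedModType R) (c : W) (x : V) : loc_lip (fun=> c) x.
Proof. by apply: (@lip_loc_lip _ _ _ _ 0) => y z; rewrite subrr normr0 mul0r. Qed.

Lemma loc_lip_nonneg (V W : normedModType R) (f : V -> W) x : loc_lip f x ->
  exists2 k, 0 <= k & exists2 A, nbhs x A &
    forall y z, A y -> A z -> `|f y - f z| <= k * `|y - z|.
Proof.
move=> [k [A xA fk]]; exists `|k| => //; exists A => // y z Ay Az.
by apply: (le_trans (fk _ _ Ay Az)); rewrite ler_wpM2r // ler_norm.
Qed.

Lemma loc_lipD (V W : normedModType R) (f g : V -> W) x :
  loc_lip f x -> loc_lip g x -> loc_lip (fun y => f y + g y) x.
Proof.
move=> [k [A xA fk]] [l [B xB gl]]; exists (k + l), (A `&` B); first exact: filterI.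
move=> y z [Ay By] [Az Bz]; rewrite opprD addrACA mulrDl.
by apply: (le_trans (ler_normD _ _)); rewrite lerD ?fk ?gl.
Qed.

Lemma loc_lip_sum (V W : normedModType R) (n : nat) (f : 'I_n -> V -> W) x :
  (forall i, loc_lip (f i) x) -> loc_lip (fun y => \sum_(i < n) f i y) x.
Proof.
move=> fL; elim: n f fL => [|n IH] f fL.
  by apply: loc_lip_near (loc_lip_cst 0 x); near=> y; rewrite big_ord0.
apply: (@loc_lip_near _ _ (fun y => \sum_(i < n) f (widen_ord (leqnSn n) i) y + f ord_max y)).
  by near=> y; rewrite big_ord_recr.
by apply: loc_lipD => //; apply: IH => i; exact: fL.
Unshelve. all: by end_near. Qed.

Lemma loc_lip_comp (U V W : normedModType R) (f : U -> V) (g : V -> W) x :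
  loc_lip f x -> loc_lip g (f x) -> loc_lip (g \o f) x.
Proof.
move=> fL /loc_lip_nonneg[l l0 [B xB gl]].
have cf := loc_lip_continuous fL; have [k [A xA fk]] := fL.
exists (l * k), (A `&` f @^-1` B); first by apply: filterI => //; exact: cf.
move=> y z [Ay By] [Az Bz] /=; apply: (le_trans (gl _ _ By Bz)).
by rewrite -mulrA ler_wpM2l // fk.
Qed.

Lemma loc_lipZ (V W : normedModType R) (c : V -> R) (f : V -> W) x :
  loc_lip c x -> loc_lip f x -> loc_lip (fun y => c y *: f y) x.
Proof.
move=> cL fL; have := loc_lip_continuous cL; have := loc_lip_continuous fL.
move/(@cvgrPdist_lt _ _ _ (nbhs x) (nbhs_filter x))/(_ 1 ltr01) => f1.
move/(@cvgrPdist_lt _ _ _ (nbhs x) (nbhs_filter x))/(_ 1 ltr01) => c1.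
have [k [A xA ck]] := cL; have [l [B xB fl]] := fL.
exists ((`|c x| + 1) * l + k * (`|f x| + 1)).
exists ((A `&` B) `&` ([set y | `|c x - c y| < 1] `&` [set y | `|f x - f y| < 1])).
  by apply: filterI; apply: filterI.
move=> y z [[Ay By] [/= cy fy]] [[Az Bz] [/= cz fz]].
have -> : c y *: f y - c z *: f z = c y *: (f y - f z) + (c y - c z) *: f z.
  by rewrite scalerBr scalerBl addrA subrK.
apply: (le_trans (ler_normD _ _)); rewrite !normrZ mulrDl.
have cb : `|c y| <= `|c x| + 1.
  have := ler_normB (c x) (c x - c y); rewrite opprB addrC subrK; lra.
have fb : `|f z| <= `|f x| + 1.
  have := ler_normB (f x) (f x - f z); rewrite opprB addrC subrK; lra.
apply: lerD; first by rewrite -mulrA ler_pM // fl.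
by rewrite mulrAC ler_pM // ck.
Qed.

Lemma loc_lip_inv (x : R) : 0 < x -> loc_lip (@GRing.inv R : R -> R) x.
Proof.
move=> x0; exists ((x / 2) ^- 2), [set y | x / 2 < y].
  by apply: lt_nbhsr; lra.
move=> y z /= xy xz.
have [y0 z0] : 0 < y /\ 0 < z by split; lra.
have -> : y^-1 - z^-1 = (z - y) / (y * z) by field; rewrite !gt_eqF.
rewrite normrM (distrC y z) mulrC normfV ler_wpM2r //.
rewrite gtr0_norm ?mulr_gt0 // lef_pV2 ?posrE ?mulr_gt0 ?exprn_gt0 ?divr_gt0 //.
nra.
Qed.

Lemma loc_lip_sqrt (x : R) : 0 < x -> loc_lip (@Num.sqrt R : R -> R) x.
Proof.
move=> x0; exists ((Num.sqrt (x / 2))^-1), [set y | x / 2 < y].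
  by apply: lt_nbhsr; lra.
move=> y z /= xy xz.
have x20 : 0 < Num.sqrt (x / 2) by rewrite sqrtr_gt0; lra.
have [sy sz] : Num.sqrt (x / 2) <= Num.sqrt y /\ Num.sqrt (x / 2) <= Num.sqrt z.
  by rewrite !ler_wsqrtr ?ltW.
rewrite mulrC ler_pdivlMr //.
have -> : `|y - z| = `|Num.sqrt y - Num.sqrt z| * (Num.sqrt y + Num.sqrt z).
  rewrite -[X in _ * X]gtr0_norm; last by lra.
  by rewrite -normrM -subr_sqr !sqr_sqrtr //; lra.
by rewrite ler_wpM2l //; lra.
Qed.

(** A Lipschitz derivative is bounded on a neighbourhood of [x]. *)
Lemma loc_lip_derive (f f' : R -> R) (k x : R) :
    (forall t : R, is_derive t 1 f (f' t)) ->
    (forall s t, `|f' s - f' t| <= k * `|s - t|) -> loc_lip f x.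
Proof.
move=> df f'k; have k0 : 0 <= k.
  by have := f'k 1 0; rewrite subr0 normr1 mulr1; exact: le_trans.
set d := `|f' x| + k.
have dB t : `|x - t| < 1 -> - d <= f' t <= d.
  move=> xt; rewrite -ler_norml /d; have := f'k x t.
  have := ler_normB (f' x) (f' x - f' t); rewrite opprB addrC subrK.
  have : k * `|x - t| <= k by rewrite ler_piMr // ltW.
  lra.
have L y z : `|x - y| < 1 -> `|x - z| < 1 -> y <= z -> `|f y - f z| <= d * `|y - z|.
  move=> xy xz yz; have /(MVT_le df yz) : forall t, y <= t <= z -> - d <= f' t <= d.
    move=> t /andP[yt tz]; apply: dB; rewrite ltr_norml.
    by move: xy xz; rewrite !ltr_norml => /andP[? ?] /andP[? ?]; apply/andP; split; lra.
  have yz' : 0 <= z - y by rewrite subr_ge0.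
  rewrite (distrC (f y)) (distrC y) (ger0_norm yz') => /andP[d1 d2].
  by rewrite ler_norml; apply/andP; split; lra.
exists d, [set t | `|x - t| < 1].
  by have := nbhsx_ballx x 1 ltr01; rewrite -ball_normE.
move=> y z /= xy xz; have [yz|/ltW zy] := leP y z; first exact: L.
by rewrite (distrC (f y)) (distrC y); exact: L.
Qed.

End locally_lipschitz.

(** * Maps that change one coordinate *)

Section shear.
Variables (R : realType) (n : nat).
Implicit Types (f g : 'rV[R]_n -> R) (x y z v : 'rV[R]_n) (i : 'I_n).

Definition C11_scalar (U : set 'rV[R]_n) f : Prop :=
  forall x, U x -> differentiable f x /\ loc_lip (gradient f) x.

(** Adding a function of the whole vector to one coordinate: both the
    straightening of the boundary and its inverse have this form, so that
    their regularity reduces to that of a scalar function. *)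
Definition shear i f x := x + f x *: delta_mx 0 i : 'rV[R]_n.

Lemma shearE i f x j : shear i f x 0 j = if j == i then x 0 i + f x else x 0 j.
Proof.
rewrite !mxE eqxx /=; case: eqP => [->|_]; first by rewrite mulr1.
by rewrite mulr0 addr0.
Qed.

Lemma differentiable_shear i f x : differentiable f x -> differentiable (shear i f) x.
Proof. by move=> df; apply: differentiableD => //; exact: differentiableZl. Qed.

Lemma diff_shear i f x v : differentiable f x ->
  'd (shear i f) x v = v + 'd f x v *: delta_mx 0 i.
Proof.
move=> df.
have di : differentiable (id : 'rV[R]_n -> 'rV[R]_n) x by [].
pose e : 'rV[R]_n := delta_mx 0 i; pose fe y := f y *: e.
have dz : differentiable fe x by exact: differentiableZl.
have E1 : 'd fe x v = 'd f x v *: e by exact: (congr1 (@^~ v) (diffZl e df)).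
have E2 : 'd (id : 'rV[R]_n -> 'rV[R]_n) x v = v.
  exact: (congr1 (@^~ v) (@diff_val _ _ _ _ _ _ _ (is_diff_id x))).
have E3 : 'd (shear i f) x v = 'd (id : 'rV[R]_n -> 'rV[R]_n) x v + 'd fe x v.
  exact: (congr1 (@^~ v) (diffD di dz)).
exact: etrans E3 (f_equal2 +%R E2 E1).
Qed.

Lemma jacobian_shear i f x : differentiable f x ->
  jacobian (shear i f) x = 1%:M + (gradient f x)^T *m delta_mx 0 i.
Proof.
move=> df; apply/row_matrixP => j; apply/rowP => k.
rewrite /jacobian rowE mul_rV_lin1 /=.
rewrite diff_shear // !mxE big_ord1 !mxE eqxx /=.
by rewrite (deriveE _ df) (eq_sym k j).
Qed.

Lemma norm_le_coord m p (A : 'M[R]_(m, p)) (k : R) : 0 <= k ->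
  (forall (i : 'I_m) j, `|A i j| <= k) -> `|A| <= k.
Proof. by move=> k0 Ak; rewrite [leLHS]mx_normrE; apply: bigmax_le => // -[i j]. Qed.

Lemma C11_on_shear (U : set 'rV[R]_n) i f : open U -> C11_scalar U f ->
  C11_on U (shear i f).
Proof.
move=> oU fU.
have L x : U x -> loc_lip (jacobian (shear i f)) x.
  move=> Ux; have [df fL] := fU x Ux.
  apply: (@loc_lip_near _ _ _ ((fun d => 1%:M + d^T *m delta_mx 0 i) \o gradient f)).
    have : nbhs x U by exact: open_nbhs_nbhs.
    by apply: filterS => y Uy /=; rewrite jacobian_shear //; have [] := fU y Uy.
  apply: loc_lip_comp => //; apply: (@lip_loc_lip _ _ _ _ _ 1) => u v.
  rewrite mul1r opprD addrACA subrr add0r -mulmxBl -linearB /=.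
  apply: norm_le_coord => // j k; rewrite !mxE big_ord1 !mxE eqxx /= normrM.
  apply: (@le_trans _ _ (`|u 0 j - v 0 j| * 1)).
    by apply: ler_wpM2l => //; case: eqP => _; rewrite ?normr0 ?normr1.
  by rewrite mulr1; have := coord_le_norm (u - v) j; rewrite !mxE.
split.
  move=> x Ux; have [df _] := fU x Ux; split; first exact: differentiable_shear.
  exact: loc_lip_continuous (L x Ux).
move=> x Ux; have [k [A xA Ak]] := L x Ux; exists A => //.
have Ax : A x by exact: nbhs_singleton.
have FA : ProperFilter (globally (A `*` A)).
  by apply: (@globally_properfilter _ _ (x, x)); split.
by apply: (@klipschitzW _ _ _ k) => -[y z] [/= Ay Az]; exact: Ak.
Qed.

Lemma diff_coord j x v : 'd (fun y : 'rV[R]_n => y 0 j : R) x v = v 0 j.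
Proof.
pose c (y : 'rV[R]_n) : R := y 0 j.
have clin : linear c by move=> r u w; rewrite /c !mxE.
pose cM := GRing.isLinear.Build _ _ _ _ _ clin.
pose cL : {linear 'rV[R]_n -> R} := HB.pack c cM.
exact: (congr1 (@^~ v) (@diff_lin _ _ _ cL x (@coord_continuous _ _ _ 0 j))).
Qed.

Lemma gradient_coord j x : gradient (fun y : 'rV[R]_n => y 0 j : R) x = delta_mx 0 j.
Proof.
apply/rowP => i; rewrite mxE deriveE ?diff_coord; last exact: differentiable_coord.
by rewrite !mxE eq_sym.
Qed.

Lemma differentiable_chain (h : R -> R) (dh : R) f x :
  differentiable f x -> is_derive (f x) 1 h dh ->
  differentiable (h \o f) x /\ gradient (h \o f) x = dh *: gradient f x.
Proof.
move=> df dh'; have d1 : derivable h (f x) 1 by apply: (@ex_derive _ _ _ _ _ _ _ dh').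
have d2 : differentiable h (f x) by apply/derivable1_diffP.
have dd : differentiable (h \o f) x by exact: differentiable_comp.
split=> //; apply/rowP => i; rewrite !mxE (deriveE _ dd) diff_comp //= deriv1E //.
by rewrite derive1E (@derive_val _ _ _ _ _ _ _ dh') (deriveE _ df) /GRing.scale /= mulrC.
Qed.

Lemma gradientB f g x : differentiable f x -> differentiable g x ->
  gradient (f - g) x = gradient f x - gradient g x.
Proof.
by move=> df dg; apply/rowP => i; rewrite !mxE deriveB //; exact: diff_derivable.
Qed.

End shear.

(** * Sums of functions of one coordinate *)

Section separable.
Variables (R : realType) (n : nat) (a a' : 'I_n -> R -> R) (k : R).
Hypothesis da : forall j (t : R), is_derive t 1 (a j) (a' j t).
Hypothesis a'k : forall j s t, `|a' j s - a' j t| <= k * `|s - t|.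
Implicit Types (x y z v : 'rV[R]_n).

Definition separable (b : 'I_n -> R -> R) x := \sum_(j < n) b j (x 0 j).

Lemma separable_term j x : differentiable (fun y => a j (y 0 j)) x /\
  forall v, 'D_v (fun y => a j (y 0 j)) x = a' j (x 0 j) * v 0 j.
Proof.
have dc : differentiable (fun y : 'rV[R]_n => y 0 j) x by exact: differentiable_coord.
have d1 : derivable (a j) (x 0 j) 1 by apply: (@ex_derive _ _ _ _ _ _ _ (da j _)).
have d2 : differentiable (a j) (x 0 j) by apply/derivable1_diffP.
have dd : differentiable (a j \o (fun y : 'rV[R]_n => y 0 j)) x.
  exact: differentiable_comp.
split=> // v; rewrite (deriveE _ dd) diff_comp //= deriv1E //.
rewrite derive1E (@derive_val _ _ _ _ _ _ _ (da j _)).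
rewrite diff_coord.
by rewrite /GRing.scale /= mulrC.
Qed.

Lemma differentiable_separable x : differentiable (separable a) x.
Proof.
have -> : separable a = \sum_(j < n) (fun y : 'rV[R]_n => a j (y 0 j)).
  by apply/funext => y; rewrite fct_sumE.
by apply: differentiable_sum => j; have [] := separable_term j x.
Qed.

Lemma gradient_separable x : gradient (separable a) x = \row_j a' j (x 0 j).
Proof.
apply/rowP => i; rewrite !mxE.
have -> : separable a = \sum_(j < n) (fun y : 'rV[R]_n => a j (y 0 j)).
  by apply/funext => y; rewrite fct_sumE.
rewrite derive_sum; last first.
  by move=> j; apply: diff_derivable; have [] := separable_term j x.
rewrite (bigD1 i) //= (separable_term i x).2 mxE !eqxx mulr1 big1 ?addr0 //.
by move=> j ji; rewrite (separable_term j x).2 mxE (negbTE ji) andbF mulr0.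
Qed.

Lemma loc_lip_coord j x : loc_lip (fun y : 'rV[R]_n => y 0 j) x.
Proof.
apply: (@lip_loc_lip _ _ _ _ _ 1) => y z; rewrite mul1r.
by have := coord_le_norm (y - z) j; rewrite !mxE.
Qed.

Lemma loc_lip_separable x : loc_lip (separable a) x.
Proof.
apply: loc_lip_sum => j.
apply: (@loc_lip_comp _ _ _ _ (fun y : 'rV[R]_n => y 0 j) (a j)).
  exact: loc_lip_coord.
exact: loc_lip_derive (da j) (a'k j).
Qed.

Lemma continuous_separable : continuous (separable a).
Proof. by move=> x; apply/loc_lip_continuous/loc_lip_separable. Qed.

Lemma loc_lip_gradient_separable x : loc_lip (gradient (separable a)) x.
Proof.
apply: (@lip_loc_lip _ _ _ _ _ `|k|) => y z; apply: norm_le_coord.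
  by rewrite mulr_ge0.
move=> i j; rewrite !gradient_separable !mxE; apply: (le_trans (a'k _ _ _)).
apply: (@le_trans _ _ (`|k| * `|y 0 j - z 0 j|)).
  by apply: ler_wpM2r => //; exact: ler_norm.
by apply: ler_wpM2l => //; have := coord_le_norm (y - z) j; rewrite !mxE.
Qed.

Lemma C11_separable U : C11_scalar U (separable a).
Proof.
by move=> x _; split; [exact: differentiable_separable|exact: loc_lip_gradient_separable].
Qed.

End separable.

(** * Straightening a level set *)

(** The region [U] is the half-space on which the [i]-th term of the sum [G] is
    the square [(z_i - b)^2], up to a constant, with [z_i - b] of the sign
    [eps]. The map [sigma] replaces the coordinate [z_i] by [G z - 1]. On its
    image, [S] recovers [(z_i - b)^2] from [G z - 1] and the other coordinates,
    and [tau] replaces the [i]-th coordinate by [b] plus the square root of [S]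
    with the sign [eps]. *)

Section graph.
Variables (R : realType) (n : nat) (a a' : 'I_n -> R -> R) (k : R).
Hypothesis da : forall j (t : R), is_derive t 1 (a j) (a' j t).
Hypothesis a'k : forall j s t, `|a' j s - a' j t| <= k * `|s - t|.
Variables (i : 'I_n) (eps b c : R).
Hypothesis eps2 : eps ^+ 2 = 1.
Hypothesis ai : forall t, 2 < eps * t -> a i t = (t - b) ^+ 2 + c /\ 0 < eps * (t - b).
Implicit Types (x y z v : 'rV[R]_n).
Let G := separable a.

Let k_ge0 : 0 <= k.
Proof. by have := a'k i 1 0; rewrite subr0 normr1 mulr1; exact: le_trans. Qed.

Let sig j t := if j == i then a i t - 1 - t else a j t.
Let sig' j t := if j == i then a' i t - 1 else a' j t.

Let dsig j (t : R) : is_derive t 1 (sig j) (sig' j t).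
Proof.
rewrite /sig /sig'; case: eqP => // _.
have := da i t => dai; have -> : (fun t => a i t - 1 - t) = a i - cst 1 - id by [].
by apply: is_derive_eq; rewrite subr0.
Qed.

Let sig'k j s t : `|sig' j s - sig' j t| <= k * `|s - t|.
Proof.
by rewrite /sig'; case: eqP => // _; rewrite opprB addrA subrK.
Qed.

Let rad j t := if j == i then t + (1 - c) else - a j t.
Let rad' j t := if j == i then 1 else - a' j t.

Let drad j (t : R) : is_derive t 1 (rad j) (rad' j t).
Proof.
rewrite /rad /rad'; case: eqP => // _.
  have -> : (fun t => t + (1 - c)) = id + cst (1 - c) by [].
  by apply: is_derive_eq; rewrite addr0.
by have := da j t => daj; exact: is_deriveN.
Qed.

Let rad'k j s t : `|rad' j s - rad' j t| <= k * `|s - t|.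
Proof.
rewrite /rad'; case: eqP => // _; first by rewrite subrr normr0 mulr_ge0.
by rewrite -opprD normrN; exact: a'k.
Qed.

Let S := separable rad.
Let root (t : R) := b + eps * Num.sqrt t.
Let U : set 'rV[R]_n := [set z | 2 < eps * z 0 i].
Let sigma : 'rV[R]_n -> 'rV[R]_n := shear i (separable sig).
Let lift_by y := root (S y) - y 0 i.
Let tau : 'rV[R]_n -> 'rV[R]_n := shear i lift_by.
Let W : set 'rV[R]_n := [set y | 0 < S y /\ 2 - eps * b < Num.sqrt (S y)].

Let separable_others x y (f g : 'I_n -> R -> R) :
  (forall j, j != i -> f j (x 0 j) = g j (y 0 j)) ->
  separable f x - f i (x 0 i) = separable g y - g i (y 0 i).
Proof.
move=> fg; rewrite /separable (bigD1 i) //= (bigD1 i (F := fun j => g j (y 0 j))) //=.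
rewrite [f i _ + _]addrC addrK [g i _ + _]addrC addrK.
exact: eq_bigr.
Qed.

Let sigi t : sig i t = a i t - 1 - t.
Proof. by rewrite /sig eqxx. Qed.

Let radi t : rad i t = t + (1 - c).
Proof. by rewrite /rad eqxx. Qed.

Let sigma_coord z : sigma z 0 i = G z - 1.
Proof.
rewrite /sigma shearE eqxx.
have := @separable_others z z sig a; rewrite sigi => E.
have : separable sig z - (a i (z 0 i) - 1 - z 0 i) = separable a z - a i (z 0 i).
  by apply: E => j /negbTE ji; rewrite /sig ji.
rewrite /G; lra.
Qed.

Let S_sigma z : U z -> S (sigma z) = (z 0 i - b) ^+ 2.
Proof.
move=> /ai[ez _].
have := @separable_others (sigma z) z rad (fun j t => - a j t).
rewrite radi sigma_coord => E.
have {E} : S (sigma z) - (G z - 1 + (1 - c)) = separable (fun j t => - a j t) z - - a i (z 0 i).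
  by apply: E => j ji; rewrite /rad /sigma shearE (negbTE ji).
rewrite {1}/separable sumrN -/(separable a z) -/G ez; lra.
Qed.

Let sigmaK z : U z -> tau (sigma z) = z.
Proof.
move=> Uz; apply/rowP => j; rewrite /tau shearE; case: eqP => [->|/eqP ji]; last first.
  by rewrite /sigma shearE (negbTE ji).
rewrite /lift_by /root S_sigma // sqrtr_sqr addrC subrK.
have [_ ez] := ai Uz.
have -> : `|z 0 i - b| = eps * (z 0 i - b).
  rewrite -[RHS]gtr0_norm // normrM.
  have -> : `|eps| = 1.
    by apply/eqP; rewrite -(@eqrXn2 _ 2) ?ler01 // real_normK ?num_real // eps2 expr1n.
  by rewrite mul1r.
by rewrite mulrA -expr2 eps2 mul1r addrC subrK.
Qed.

Let tau_coord y : tau y 0 i = root (S y).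
Proof. by rewrite /tau shearE eqxx /lift_by addrC subrK. Qed.

Let tau_in_U y : W y -> U (tau y).
Proof.
move=> [_ Wy]; rewrite /U /= tau_coord /root mulrDr mulrA -expr2 eps2 mul1r; lra.
Qed.

Let tauK y : W y -> sigma (tau y) = y.
Proof.
move=> Wy; apply/rowP => j; have [->|ji] := eqVneq j i; last first.
  by rewrite /sigma /tau !shearE (negbTE ji).
rewrite sigma_coord.
have [ez _] := ai (tau_in_U Wy).
have := @separable_others y (tau y) rad (fun j t => - a j t).
rewrite radi => E.
have {E} : S y - (y 0 i + (1 - c)) = separable (fun j t => - a j t) (tau y) - - a i (tau y 0 i).
  by apply: E => j' ji; rewrite /rad /tau shearE (negbTE ji).
rewrite {1}/separable sumrN -/(separable a _) -/G ez tau_coord /root.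
have -> : (b + eps * Num.sqrt (S y) - b) ^+ 2 = S y.
  by rewrite addrC addKr exprMn eps2 mul1r sqr_sqrtr // ltW //; case: Wy.
lra.
Qed.

Let image_sigma : sigma @` U = W.
Proof.
apply/seteqP; split=> [_ [z Uz <-]|y Wy]; last first.
  by exists (tau y); [exact: tau_in_U|exact: tauK].
have [_ ez] := ai Uz; have Sz := S_sigma Uz.
have e0 : 0 < S (sigma z).
  by rewrite Sz exprn_even_gt0 //=; apply: contraTneq ez => ->; rewrite mulr0 ltxx.
split=> //; have := Uz; rewrite /U /= -{1}(sigmaK Uz) tau_coord /root.
rewrite mulrDr mulrA -expr2 eps2 mul1r; lra.
Qed.

Let cS : continuous S.
Proof. exact: continuous_separable drad rad'k. Qed.

Let oU : open U.
Proof.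
apply: (@open_comp _ _ (fun z : 'rV[R]_n => eps * z 0 i) [set r | 2 < r]); last exact: open_gt.
move=> z _; apply: (@continuous_comp _ _ _ (fun z : 'rV[R]_n => z 0 i) ( *%R eps)).
  exact: coord_continuous.
exact: mulrl_continuous.
Qed.

Let oW : open W.
Proof.
apply: (@open_comp _ _ S ([set r | 0 < r] `&` (Num.sqrt @^-1` [set r | 2 - eps * b < r]))).
  by move=> z _; exact: cS.
apply: openI; first exact: open_gt.
by apply: open_comp => [r _|]; [exact: sqrt_continuous|exact: open_gt].
Qed.

Let C11_tau : C11_scalar W lift_by.
Proof.
have dh (t : R) : 0 < t -> is_derive t 1 root (eps * (2 * Num.sqrt t)^-1).
  move=> t0; have ds := is_derive1_sqrt t0.
  have := @is_deriveD _ _ _ (cst b) _ t 1 0 _ (is_derive_cst b t 1) (is_deriveZ eps ds).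
  by rewrite add0r.
have E y : W y -> differentiable lift_by y /\
    gradient lift_by y = (eps * (2 * Num.sqrt (S y))^-1) *: gradient S y - delta_mx 0 i.
  move=> [Sy _]; have [d1 g1] := differentiable_chain (differentiable_separable drad y) (dh _ Sy).
  have dc : differentiable (fun y : 'rV[R]_n => y 0 i : R) y by exact: differentiable_coord.
  have -> : lift_by = (root \o S) - (fun y => y 0 i) by [].
  by split; [exact: differentiableB|rewrite gradientB // g1 gradient_coord].
move=> y Wy; have [dg _] := E y Wy; split=> //.
have : \forall z \near y,
    (eps * (2 * Num.sqrt (S z))^-1) *: gradient S z - delta_mx 0 i = gradient lift_by z.
  have := open_nbhs_nbhs (conj oW Wy).
  by apply: filterS => z Wz; have [_ ->] := E z Wz.
move/loc_lip_near; apply; apply: loc_lipD; last exact: loc_lip_cst.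
apply: loc_lipZ; last exact: loc_lip_gradient_separable drad rad'k _.
have [Sy _] := Wy.
apply: (@loc_lipZ _ _ _ (fun=> eps) (fun z => (2 * Num.sqrt (S z))^-1 : R^o)).
  exact: loc_lip_cst.
apply: (@loc_lip_comp _ _ _ _ (fun z => 2 * Num.sqrt (S z)) (@GRing.inv R)); last first.
  by apply: loc_lip_inv; rewrite mulr_gt0 // sqrtr_gt0.
apply: (@loc_lipZ _ _ _ (fun=> 2) (fun z => Num.sqrt (S z) : R^o)).
  exact: loc_lip_cst.
apply: (@loc_lip_comp _ _ _ _ S (@Num.sqrt R)); last exact: loc_lip_sqrt.
exact: loc_lip_separable drad rad'k _.
Qed.

Let coord_hyperplane : exists Z : {vspace 'rV[R]_n},
  \dim Z = n.-1 /\ [set z | z \in Z] = [set z | z 0 i = 0].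
Proof.
pose l (z : 'rV[R]_n) : R^o := z 0 i.
have llin : linear l by move=> r u w; rewrite /l !mxE.
pose lM := GRing.isLinear.Build _ _ _ _ _ llin.
pose lL : {linear 'rV[R]_n -> R^o} := HB.pack l lM.
pose f := linfun lL.
have fE z : f z = z 0 i by rewrite lfunE.
exists (lker f); split.
  have f1e : (f @: fullv)%VS = fullv.
    apply/eqP; rewrite eqEsubv subvf /=; apply/subvP => r _.
    have -> : r = f (r *: delta_mx 0 i) by rewrite fE !mxE !eqxx mulr1.
    exact: memv_img (memvf _).
  have := limg_ker_dim f fullv.
  rewrite capfv f1e !dimvf addn1 => E.
  exact: (congr1 predn (etrans E (mul1n n))).
by apply/seteqP; split => z /=; rewrite memv_ker fE => /eqP.
Qed.

Lemma graph_hypersurface z : G z = 1 -> U z ->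
  exists (U : set 'rV[R]_n) (Z : {vspace 'rV[R]_n}) (s : 'rV[R]_n -> 'rV[R]_n),
    [/\ U z, \dim Z = n.-1, diffeo_on (@C11_on R n n) U s &
        s @` (U `&` [set z | G z = 1]) = [set z | z \in Z] `&` s @` U].
Proof.
move=> Gz Uz; have [Z [dZ EZ]] := coord_hyperplane.
exists U, Z, sigma; split=> //.
  split => //.
  - by rewrite image_sigma.
  - by apply: C11_on_shear => //; exact: C11_separable dsig sig'k _.
  - exists tau; first by move=> x /set_mem; exact: sigmaK.
    by rewrite image_sigma; exact: C11_on_shear.
rewrite EZ; apply/seteqP; split => [_ [x [Ux /= Gx] <-]|y [/= y0 [x Ux E]]].
  by split; [rewrite /= sigma_coord Gx subrr|exists x].
by move: y0; rewrite -E sigma_coord => /eqP; rewrite subr_eq0 => /eqP Gx; exists x.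
Qed.

End graph.

(** * The square of the distance to an interval *)

Section flat.
Variable R : realType.
Implicit Types s t x : R.

Definition sqpos t : R := Num.max t 0 ^+ 2.
(** The squared distance of [t] from [-2, 2], see [flatE], in a form that is easy
    to differentiate. *)
Definition flat t : R := sqpos (t - 2) + sqpos (- t - 2).
Definition flat' t : R := 2 * Num.max (t - 2) 0 - 2 * Num.max (- t - 2) 0.

(** Both sides are antiderivatives of the same Lipschitz function that vanish on
    the negative half-line; this avoids computing a limit at 0. *)
Lemma is_derive_sqpos t : is_derive t 1 sqpos (2 * Num.max t 0).
Proof.
have [||f [df f0]] := @lipschitz_antiderivative R (fun t => 2 * Num.max t 0) 2 0.
- by move=> x y xy; case: (leP x 0) => ?; case: (leP y 0) => ?; apply/andP; split; lra.
- by move=> x x0; case: (leP x 0); lra.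
suff -> : sqpos = f by exact: df.
apply/funext => x; rewrite /sqpos; have [x0|x0] := leP x 0.
  by rewrite f0 // expr0n.
have dg (y : R) : is_derive y 1 (f - (id ^+ 2)) (2 * Num.max y 0 - 2 * y).
  have := is_deriveB (df y) (is_deriveX 2 (is_derive_id y (1 : R))).
  by move/is_derive_eq; apply; rewrite /GRing.scale /=; ring.
have := MVT_le dg (ltW x0) (c := 0) (d := 0).
have H z : 0 <= z <= x -> 0 <= 2 * Num.max z 0 - 2 * z <= 0.
  by move=> /andP[z0 _]; case: (leP z 0) => ?; apply/andP; split; lra.
move=> /(_ H); rewrite !mul0r.
have -> : (f - id ^+ 2) x = f x - x ^+ 2 by [].
have -> : (f - id ^+ 2) 0 = 0 by rewrite -[LHS]/(f 0 - 0 * 0) f0 // mul0r subrr.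
lra.
Qed.

Lemma is_derive_flat t : is_derive t 1 flat (flat' t).
Proof.
have d1 := @is_derive1_comp _ sqpos (id - cst 2) t _ _
  (is_derive_sqpos (t - 2)) (is_deriveB (is_derive_id t (1:R)) (is_derive_cst (2 : R) t 1)).
have d2 := @is_derive1_comp _ sqpos (- id - cst 2) t _ _
  (is_derive_sqpos (- t - 2))
  (is_deriveB (is_deriveN (is_derive_id t (1:R))) (is_derive_cst (2 : R) t 1)).
have := is_deriveD d1 d2.
by move/is_derive_eq; apply; rewrite /flat' /=; ring.
Qed.

Lemma flat'_ndecr s t : s <= t -> flat' s <= flat' t.
Proof.
rewrite /flat' => st.
case: (leP (s - 2) 0) => ?; case: (leP (t - 2) 0) => ?;
case: (leP (- s - 2) 0) => ?; case: (leP (- t - 2) 0) => ?; lra.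
Qed.

Lemma flat'_lipschitz s t : s <= t -> flat' t - flat' s <= 4 * (t - s).
Proof.
rewrite /flat' => st.
case: (leP (s - 2) 0) => ?; case: (leP (t - 2) 0) => ?;
case: (leP (- s - 2) 0) => ?; case: (leP (- t - 2) 0) => ?; lra.
Qed.

Lemma flatE t : flat t = Num.max (`|t| - 2) 0 ^+ 2.
Proof.
rewrite /flat /sqpos; case: (ger0P t) => t0.
  have -> : Num.max (- t - 2) 0 = 0 by apply: max_r; lra.
  by rewrite expr0n addr0.
have -> : Num.max (t - 2) 0 = 0 by apply: max_r; lra.
by rewrite expr0n add0r.
Qed.

Lemma flat_ge0 t : 0 <= flat t. Proof. by rewrite flatE sqr_ge0. Qed.

Lemma flat0 t : `|t| <= 2 -> flat t = 0.
Proof. by move=> t2; rewrite flatE max_r ?expr0n // subr_le0. Qed.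

Lemma flat_gt t : 2 < t -> flat t = (t - 2) ^+ 2.
Proof. by move=> t2; rewrite flatE gtr0_norm ?max_l //; lra. Qed.

Lemma flat_lt t : t < -2 -> flat t = (t + 2) ^+ 2.
Proof. by move=> t2; rewrite flatE ltr0_norm ?max_l //; [ring|lra|lra]. Qed.

Lemma flat_le1 t : flat t <= 1 -> `|t| <= 3.
Proof.
rewrite flatE; have [t2 _|t2] := leP (`|t| - 2) 0; first by lra.
rewrite -{2}(expr1n _ 2%N) ler_sqr ?nnegrE ?ler01 ?(ltW t2) //; lra.
Qed.

End flat.

Lemma C11_C1_hypersurface (R : realType) (n : nat) (M : set 'rV[R]_n) :
  C11_hypersurface M -> C1_hypersurface M.
Proof.
move=> hM a /hM[U [Z [s [Ua dZ [oU osU [C1s _] [tau ts [C1t _]]] E]]]].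
by exists U, Z, s; split=> //; split=> //; exists tau.
Qed.

(** * Distances from a point of the cube *)

Section sums.
Variables (R : realType) (I : finType) (P : pred I) (t : I -> R) (w d : R).
Hypotheses (t0 : forall i, 0 <= t i) (w0 : 0 <= w) (d0 : 0 <= d).
Hypothesis tw : \sum_(i | P i) t i ^+ 2 = w ^+ 2.

Lemma le_sum_of_squares : w <= \sum_(i | P i) t i.
Proof.
have [w_eq0|w_gt0] := eqVneq w 0; first by rewrite w_eq0 sumr_ge0.
have {}w_gt0 : 0 < w by rewrite lt_neqAle eq_sym w_gt0.
rewrite -(ler_pM2l w_gt0) -expr2 -tw mulr_sumr; apply: ler_sum => i Pi.
rewrite expr2 ler_wpM2r // -ler_sqr ?nnegrE // -tw (bigD1 i) //=.
by rewrite lerDl sumr_ge0 // => j _; exact: sqr_ge0.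
Qed.

Lemma sum_sqr_linear : w ^+ 2 + 2 * d * w <= \sum_(i | P i) (t i ^+ 2 + 2 * d * t i).
Proof.
rewrite big_split /= tw lerD2l -mulr_sumr; apply: ler_wpM2l; last exact: le_sum_of_squares.
by rewrite mulr_ge0.
Qed.

(** In the application [t] lists the amounts by which the coordinates of a
    boundary point exceed the cube and [d] is the distance of a point of the
    cube from the nearest face: among all [t] of given length [w], the distance
    is least when a single coordinate exceeds the cube, because the sum of the
    [t i] is at least [w]. *)
Lemma sum_sqr_shift : 0 < w -> (w + d) ^+ 2 <=
  \sum_(i | P i) (t i ^+ 2 + 2 * d * t i + (if 0 < t i then d ^+ 2 else 0)).
Proof.
move=> w_gt0; rewrite big_split /=.
have [i Pi ti] : exists2 i, P i & 0 < t i.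
  apply: contrapT => nt; have : w ^+ 2 = 0.
    rewrite -tw big1 // => i Pi; apply/eqP; rewrite sqrf_eq0 eq_le t0 andbT leNgt.
    by apply/negP => ti; apply: nt; exists i.
  by apply/eqP; rewrite sqrf_eq0 gt_eqF.
have : d ^+ 2 <= \sum_(i | P i) (if 0 < t i then d ^+ 2 else 0).
  rewrite (bigD1 i) //= ti lerDl sumr_ge0 // => j _.
  by case: ifP => // _; exact: sqr_ge0.
have := sum_sqr_linear; lra.
Qed.

End sums.

(** Once [z] exceeds [-2, 2] by [t], its distance from [x] is at least [t + d];
    the lower bound is the expansion of the square of that number. *)
Lemma sqr_dist_coord (R : realType) (x z d : R) : 0 <= d -> `|x| <= 2 - d ->
  let t := Num.max (`|z| - 2) 0 in
  t ^+ 2 + 2 * d * t + (if 0 < t then d ^+ 2 else 0) <= (x - z) ^+ 2.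
Proof.
move=> d0 xd /=; have [z2|z2] := leP (`|z| - 2) 0.
  by rewrite ltxx expr0n mulr0 !addr0 sqr_ge0.
rewrite z2.
have H : `|z| - 2 + d <= `|x - z|.
  have := ler_normB x (x - z); rewrite opprB addrC subrK; lra.
rewrite -(real_normK (num_real (x - z))).
have H0 : 0 <= `|z| - 2 + d by lra.
have := ler_sqr H0 (normr_ge0 (x - z)); rewrite H; lra.
Qed.

(** * The body and its singular set *)

Section body.
Variables (R : realType) (m : nat) (eta eta' : R -> R).
Hypothesis deta : forall x : R, is_derive x 1 eta (eta' x).
Hypothesis eta'L : forall x y : R, x <= y -> 0 <= eta' y - eta' x <= 4 * (y - x).
Hypothesis eta0 : forall x : R, x <= -2 -> eta x = 0.
Hypothesis eta'B : forall x : R, 0 <= eta' x <= 1/20.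
Hypothesis etaE : forall x : R, 2 <= x -> eta x = eta 2 + eta' 2 * (x - 2).
Hypothesis eta_curved : forall a b : R, -2 <= a -> a < b -> b <= 2 -> exists s h : R,
  [/\ a < s < b, 0 < h, -2 <= s - h, s + h <= 2 &
      2 * h ^+ 2 < eta (s + h) + eta (s - h) - eta s *+ 2].

Lemma eta_bounds x : x <= 3 -> 0 <= eta x <= 1/4.
Proof.
move=> x3; have [x2|x2] := leP x (-2); first by rewrite eta0 //; lra.
have := MVT_le deta (ltW x2) (c := 0) (d := 1/20).
by move=> /(_ (fun z _ => eta'B z)); rewrite (eta0 (lexx (-2))); lra.
Qed.

Lemma eta_ge0 x : 0 <= eta x.
Proof.
have [x2|x2] := leP x (-2); first by rewrite eta0.
have := MVT_le deta (ltW x2) (c := 0) (d := 1/20).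
by move=> /(_ (fun z _ => eta'B z)); rewrite (eta0 (lexx (-2))); lra.
Qed.

Lemma eta_midconvex s h : 2 * eta s <= eta (s + h) + eta (s - h).
Proof.
have T x y : eta x + eta' x * (y - x) <= eta y.
  by apply: (convex_tangent deta) => a b /eta'L; lra.
have := T s (s + h); have := T s (s - h).
rewrite [s + h]addrC [s - h]addrC !addrK; lra.
Qed.

Let n := m.+2.
Let o0 : 'I_n := ord0.
Let o1 : 'I_n := lift ord0 ord0.
Implicit Types (x y z : 'rV[R]_n).

Definition profile (j : 'I_n) (t : R) : R :=
  if j == ord0 then flat t + eta t else flat t.
Definition profile' (j : 'I_n) (t : R) : R :=
  if j == ord0 then flat' t + eta' t else flat' t.

Lemma is_derive_profile j (t : R) : is_derive t 1 (profile j) (profile' j t).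
Proof.
rewrite /profile /profile'; case: eqP => _; last exact: is_derive_flat.
exact: (is_deriveD (is_derive_flat t) (deta t)).
Qed.

Lemma profile'_ndecr j (s t : R) : s <= t -> profile' j s <= profile' j t.
Proof.
move=> st; have := flat'_ndecr st; have := eta'L st; rewrite /profile'.
by case: eqP => _; lra.
Qed.

Lemma profile'_lip j (s t : R) : `|profile' j s - profile' j t| <= 8 * `|s - t|.
Proof.
wlog st : s t / t <= s => [W|].
  by have [/W//|/ltW/W] := leP t s; rewrite distrC (distrC s).
rewrite !ger0_norm ?subr_ge0 ?profile'_ndecr //.
have := flat'_lipschitz st; have := eta'L st; rewrite /profile'.
by case: eqP => _; lra.
Qed.

Definition barrel : 'rV[R]_n -> R := separable profile.

Lemma barrelE z : barrel z = \sum_(j < n) flat (z 0 j) + eta (z 0 o0).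
Proof.
rewrite /barrel /separable big_ord_recl [in RHS]big_ord_recl /= /profile eqxx.
by rewrite addrAC.
Qed.

Lemma continuous_barrel : continuous barrel.
Proof. exact: continuous_separable is_derive_profile profile'_lip. Qed.

Lemma barrel_subgradient z : exists w, forall y, barrel z + dotp (y - z) w <= barrel y.
Proof.
exists (\row_j profile' j (z 0 j)) => y.
rewrite /barrel /separable /dotp -big_split; apply: ler_sum => j _ /=.
rewrite !mxE mulrC.
exact: (convex_tangent (is_derive_profile j) (@profile'_ndecr j)).
Qed.

Lemma barrel_in_cube z : (forall j, `|z 0 j| <= 2) -> barrel z = eta (z 0 o0).
Proof. by move=> z2; rewrite barrelE big1 ?add0r // => j _; exact: flat0. Qed.

Lemma barrel_0 : barrel 0 < 1.
Proof.
rewrite barrel_in_cube => [|j]; rewrite mxE; last by rewrite normr0.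
have := @eta_bounds 0; lra.
Qed.

Lemma barrel_coord z j : barrel z <= 1 -> `|z 0 j| <= 3.
Proof.
rewrite barrelE (bigD1 j) //= => Gz; apply: flat_le1.
have : 0 <= \sum_(i < n | i != j) flat (z 0 i) by rewrite sumr_ge0 // => i _; exact: flat_ge0.
have := eta_ge0 (z 0 o0); lra.
Qed.

Lemma compact_barrel : compact (sublevel barrel).
Proof.
apply: bounded_closed_compact; last exact: closed_sublevel continuous_barrel.
exists 3; split; first exact: num_real.
move=> M M3 z Gz; apply: norm_le_coord; first by lra.
by move=> i j; rewrite ord1; have := barrel_coord j Gz; lra.
Qed.

Let K := [set z | barrel z = 1].

(** Beyond 2 the function [eta] is affine, and completing the square turns
    [(t - 2)^2] plus an affine function into a translate of [t^2], up to a
    constant; below -2 it vanishes. *)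
Lemma profile_quadratic j (r : R) : 2 < `|r| -> exists eps b c : R,
  [/\ eps ^+ 2 = 1, 2 < eps * r & forall t, 2 < eps * t ->
    profile j t = (t - b) ^+ 2 + c /\ 0 < eps * (t - b)].
Proof.
have p := eta'B 2.
rewrite ltr_normr => /orP[r2|r2].
  pose q := if j == ord0 then eta' 2 / 2 else 0.
  exists 1, (2 - q), (if j == ord0 then eta 2 - q ^+ 2 else 0).
  split; [exact: expr1n|by rewrite mul1r|move=> t; rewrite !mul1r => t2].
  rewrite /profile /q flat_gt //; case: eqP => _; split; try lra.
  by rewrite etaE ?(ltW t2) //; field.
exists (-1), (-2), 0.
split; [by rewrite sqrrN expr1n|by rewrite mulN1r|move=> t; rewrite !mulN1r => t2].
rewrite /profile flat_lt; last lra; rewrite eta0; last lra.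
by case: eqP => _; split; try lra; ring.
Qed.

(** On the cube the sum equals [eta], which is at most [1/4]. *)
Lemma levelset_outside_cube z : barrel z = 1 -> exists j, 2 < `|z 0 j|.
Proof.
move=> Gz; apply: contrapT => nj.
have zj j : `|z 0 j| <= 2 by rewrite leNgt; apply/negP => jz; apply: nj; exists j.
have := zj o0; rewrite ler_norml => z0.
have : barrel z = eta (z 0 o0) by exact: barrel_in_cube.
have := @eta_bounds (z 0 o0); rewrite Gz; lra.
Qed.

Lemma C11_levelset : C11_hypersurface K.
Proof.
move=> z Gz; have [j zj] := levelset_outside_cube Gz.
have [eps [b [c [e2 ez q]]]] := profile_quadratic j zj.
exact: (graph_hypersurface is_derive_profile profile'_lip e2 q Gz ez).
Qed.

(** The height of the boundary above the face [z_1 = 2] of the cube, where the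
    first coordinate is [t]. *)
Let W t := Num.sqrt (1 - eta t).

Let W_ge0 t : 0 <= W t. Proof. exact: sqrtr_ge0. Qed.

Let sqrW t : t <= 3 -> W t ^+ 2 = 1 - eta t.
Proof. by move=> /eta_bounds te; rewrite sqr_sqrtr //; lra. Qed.

Let W_bounds t : t <= 3 -> 3/4 <= W t <= 1.
Proof.
move=> t3; have := eta_bounds t3; have := sqrW t3; have := W_ge0 t => w0 w2 te.
apply/andP; split; nra.
Qed.

Let W_midconcave s h : s - h <= 3 -> s + h <= 3 -> W (s + h) + W (s - h) <= 2 * W s.
Proof.
move=> h1 h2; have s3 : s <= 3 by lra.
have := eta_midconvex s h; have := sqrW h1; have := sqrW h2; have := sqrW s3.
have := W_ge0 s; have := W_ge0 (s + h); have := W_ge0 (s - h).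
move: (W s) (W (s + h)) (W (s - h)) => p q r p0 q0 r0 p2 q2 r2 e2.
rewrite -ler_sqr ?nnegrE; [|lra|lra].
have := sqr_ge0 (q - r); nra.
Qed.

(** The boundary point with first coordinate [s] on the side of [z_1 = 2] that is
    closest to [x]. *)
Let face_point x s : 'rV[R]_n :=
  \row_j if j == o0 then s else if j == o1 then 2 + W s else x 0 j.

Let big_first_two (F : 'I_n -> R) : \sum_(j < n) F j =
  F o0 + (F o1 + \sum_(j < m) F (lift ord0 (lift ord0 j))).
Proof. by rewrite !big_ord_recl. Qed.

(** Points so close to the face [z_1 = 2], and so far from the other faces,
    that their nearest boundary points have a first coordinate in ]-2, 2[. *)
Definition window x := 1 < x 0 o1 < 3/2 /\ forall j, j != o1 -> `|x 0 j| < 1/2.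

Let window_le2 x j : window x -> `|x 0 j| <= 2 - (2 - x 0 o1).
Proof.
move=> [x1 xj]; have [->|/xj] := eqVneq j o1; last lra.
by rewrite ger0_norm; lra.
Qed.

Let face_point0 x s : face_point x s 0 o0 = s. Proof. by rewrite mxE eqxx. Qed.

Let face_pointK x s : window x -> -2 <= s <= 2 -> K (face_point x s).
Proof.
move=> gx s2; rewrite /K /= barrelE big_first_two face_point0 !mxE /= big1 => [|j _]; last first.
  rewrite !mxE /=; apply: flat0; have := window_le2 (lift ord0 (lift ord0 j)) gx.
  by case: gx; lra.
have Wb : 3/4 <= W s <= 1 by apply: W_bounds; lra.
rewrite flat0; last by rewrite ler_norml.
rewrite flat_gt; last by lra.
have -> : 2 + W s - 2 = W s by ring.
rewrite sqrW; lra.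
Qed.

Let D x s := (x 0 o0 - s) ^+ 2 + (2 - x 0 o1 + W s) ^+ 2.

Let face_point_dist x s : dotp (x - face_point x s) (x - face_point x s) = D x s.
Proof.
rewrite /dotp big_first_two !mxE /= big1 => [|j _]; last by rewrite !mxE /= subrr mulr0.
rewrite /D; ring.
Qed.

(** If [z_0] is in ]-2, 2[, the remaining coordinates of [z] exceed the cube by
    amounts whose squares add up to [W (z_0)^2], and [sum_sqr_shift] applies to
    them. Otherwise the first coordinate alone contributes at least [(3/2)^2],
    and [z] is farther away than [face_point x (x_0)], whose distance from [x]
    is at most [3 - x_1] because [W] is at most 1. *)
Let levelset_dist x z : window x -> K z ->
  (`|z 0 o0| < 2 /\ D x (z 0 o0) <= dotp (x - z) (x - z)) \/
  (3 - x 0 o1) ^+ 2 < dotp (x - z) (x - z).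
Proof.
move=> gx Kz; have [x1 xj] := gx; set d := 2 - x 0 o1.
have d01 : 1/2 < d < 1 by rewrite /d; lra.
pose t j := Num.max (`|z 0 j| - 2) 0.
have t0 j : 0 <= t j by rewrite le_max lexx orbT.
have st : \sum_j t j ^+ 2 = 1 - eta (z 0 o0).
  have <- : \sum_j flat (z 0 j) = \sum_j t j ^+ 2 by apply: eq_bigr => j _; rewrite flatE.
  have := Kz; rewrite /K /= barrelE; lra.
have z3 : z 0 o0 <= 3.
  by have := @barrel_coord z o0; rewrite Kz lexx ler_norml => /(_ isT); lra.
have Wb := W_bounds z3; have W2 := sqrW z3.
have xz j : t j ^+ 2 + 2 * d * t j + (if 0 < t j then d ^+ 2 else 0) <= (x 0 j - z 0 j) ^+ 2.
  by apply: sqr_dist_coord; [lra|exact: window_le2].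
have dE : dotp (x - z) (x - z) = \sum_j (x 0 j - z 0 j) ^+ 2.
  by apply: eq_bigr => j _; rewrite !mxE expr2.
have [z2|z2] := ltP `|z 0 o0| 2; [left|right].
  split=> //; rewrite dE (bigD1 o0) //= lerD2l -/d addrC.
  have t00 : t o0 = 0 by apply: max_r; lra.
  apply: (le_trans (sum_sqr_shift (P := fun j => j != o0) t0 _ _ _ _)); last first.
  - by apply: ler_sum => j _; exact: xz.
  - lra.
  - by rewrite W2 -st [RHS](bigD1 o0) //= t00 expr0n add0r.
  - lra.
  - lra.
rewrite dE (bigD1 o0) //=.
have -> : 3 - x 0 o1 = 1 + d by rewrite /d; ring.
have S : W (z 0 o0) ^+ 2 + 2 * d * W (z 0 o0) <= \sum_j (t j ^+ 2 + 2 * d * t j).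
  by apply: sum_sqr_linear => //; [lra|rewrite W2 -st].
rewrite (bigD1 o0) //= in S.
have S' : \sum_(j < n | j != o0) (t j ^+ 2 + 2 * d * t j) <=
    \sum_(j < n | j != o0) (x 0 j - z 0 j) ^+ 2.
  apply: ler_sum => j _; apply: le_trans (xz j).
  by rewrite lerDl; case: ifP => // _; exact: sqr_ge0.
have H0 : (3/2) ^+ 2 + 2 * d * t o0 + t o0 ^+ 2 <= (x 0 o0 - z 0 o0) ^+ 2.
  have tE : t o0 = `|z 0 o0| - 2 by apply: max_l; lra.
  have x00 : `|x 0 o0| < 1/2 by exact: xj.
  have H : 3/2 + t o0 <= `|x 0 o0 - z 0 o0|.
    have := ler_normB (x 0 o0) (x 0 o0 - z 0 o0); rewrite opprB addrC subrK; lra.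
  rewrite -(real_normK (num_real (x 0 o0 - z 0 o0))).
  have H1 : 0 <= 3/2 + t o0 by have := t0 o0; lra.
  have := ler_sqr H1 (normr_ge0 (x 0 o0 - z 0 o0)); rewrite H.
  have := t0 o0; nra.
nra.
Qed.

Definition nearest_point x z := K z /\ forall b, K b -> enorm (x - z) <= enorm (x - b).

Let nearest_point_min x z : window x -> nearest_point x z ->
  `|z 0 o0| < 2 /\ forall s, -2 <= s <= 2 -> D x (z 0 o0) <= D x s.
Proof.
move=> gx [Kz zP].
have zD s : -2 <= s <= 2 -> dotp (x - z) (x - z) <= D x s.
  move=> s2; rewrite -face_point_dist -!sqr_enorm ler_sqr ?nnegrE ?enorm_ge0 //.
  by apply: zP; exact: face_pointK.
have [[z2 zl]|zl] := levelset_dist gx Kz.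
  by split=> // s /zD; exact: le_trans.
have [x1 /(_ o0 isT) x0] := gx; move: x0; rewrite ltr_norml => x0.
have x03 : x 0 o0 <= 3 by lra.
have := zD (x 0 o0); rewrite /D subrr expr0n add0r => /(_ _)H.
have Wb := W_bounds x03.
exfalso; have : (2 - x 0 o1 + W (x 0 o0)) ^+ 2 <= (3 - x 0 o1) ^+ 2.
  rewrite ler_sqr ?nnegrE; lra.
have := H _; lra.
Qed.

(** Expanding the square in [D], the term linear in [W] has nonpositive second
    difference by concavity, and the quadratic one is [1 - eta]. *)
Let D_second_difference x s h : window x -> s - h <= 3 -> s + h <= 3 ->
  D x (s + h) + D x (s - h) - 2 * D x s <=
  2 * h ^+ 2 - (eta (s + h) + eta (s - h) - 2 * eta s).
Proof.
move=> [x1 _] h1 h2; have s3 : s <= 3 by lra.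
have := W_midconcave h1 h2; have := sqrW h1; have := sqrW h2; have := sqrW s3.
rewrite /D; move: (W s) (W (s + h)) (W (s - h)) => p q r p2 q2 r2 c.
have := ler_wpM2l (_ : 0 <= 2 * (2 - x 0 o1)) c.
have -> : (2 - x 0 o1 + q) ^+ 2 = (2 - x 0 o1) ^+ 2 + 2 * (2 - x 0 o1) * q + q ^+ 2 by ring.
have -> : (2 - x 0 o1 + r) ^+ 2 = (2 - x 0 o1) ^+ 2 + 2 * (2 - x 0 o1) * r + r ^+ 2 by ring.
have -> : (2 - x 0 o1 + p) ^+ 2 = (2 - x 0 o1) ^+ 2 + 2 * (2 - x 0 o1) * p + p ^+ 2 by ring.
rewrite p2 q2 r2; lra.
Qed.

Let curved_at s := exists h, [/\ 0 < h, -2 <= s - h, s + h <= 2 &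
  2 * h ^+ 2 < eta (s + h) + eta (s - h) - eta s *+ 2].

Let nearest_point_not_curved x z : window x -> nearest_point x z -> ~ curved_at (z 0 o0).
Proof.
move=> gx zx [h [h0 h1 h2 h3]]; have [_ Dmin] := nearest_point_min gx zx.
have B1 : z 0 o0 - h <= 3 by lra.
have B2 : z 0 o0 + h <= 3 by lra.
have := D_second_difference gx B1 B2.
have : D x (z 0 o0) <= D x (z 0 o0 + h) by apply: Dmin; lra.
have : D x (z 0 o0) <= D x (z 0 o0 - h) by apply: Dmin; lra.
lra.
Qed.

Let slide x r : 'rV[R]_n := x + r *: delta_mx 0 o0.

Let slide0 x r : slide x r 0 o0 = x 0 o0 + r.
Proof. by rewrite !mxE !eqxx mulr1. Qed.

Let slide1 x r : slide x r 0 o1 = x 0 o1.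
Proof. by rewrite !mxE mulr0 addr0. Qed.

(** If [s] minimized both [D x] and [D (slide x r)], the concave function of [t]
    obtained from [D] by removing [(x_0 - t)^2] would lie above two
    parabolas that touch it at [s] with slopes differing by [2 * r]. Comparing
    the first parabola at [s - u] and the second at [s + u], for a step [u < r],
    contradicts concavity. *)
Let nearest_point_moves x r z z' : window x -> window (slide x r) -> 0 < r ->
  nearest_point x z -> nearest_point (slide x r) z' -> z 0 o0 != z' 0 o0.
Proof.
move=> gx gx' r0 zx zx'; apply/negP => /eqP zz'.
have [] := nearest_point_min gx zx; have [_] := nearest_point_min gx' zx'.
rewrite -zz'; move: (z 0 o0) => s Dmin' + Dmin; rewrite ltr_norml => s2.
pose u := Num.min (r / 2) (Num.min (2 - s) (2 + s)).
have [u0 ur us1 us2] : [/\ 0 < u, u < r, u <= 2 - s & u <= 2 + s].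
  by rewrite /u; case: (leP (2 - s)) => ?; case: (leP (r / 2)) => ?; split; lra.
have B1 : s - u <= 3 by lra.
have B2 : s + u <= 3 by lra.
have := D_second_difference gx B1 B2; have := eta_midconvex s u.
have : D (slide x r) s <= D (slide x r) (s + u) by apply: Dmin'; lra.
have : D x s <= D x (s - u) by apply: Dmin; lra.
rewrite /D !slide0 !slide1; nra.
Qed.

Lemma levelset_nonempty : K !=set0.
Proof.
pose p : 'rV[R]_n := (5/4) *: delta_mx 0 o1.
exists (face_point p 0); apply: face_pointK; last by lra.
split=> [|j /negbTE j1]; rewrite !mxE ?j1 !eqxx /= ?mulr1; first by lra.
by rewrite mulr0 normr0; lra.
Qed.

Let cK : compact K.
Proof. exact: compact_levelset continuous_barrel compact_barrel. Qed.

Let half_compact (P : set R) : closed P -> compact [set z | K z /\ P (z 0 o0)].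
Proof.
move=> cP; apply: (subclosed_compact _ cK); last by move=> z [].
rewrite (_ : [set _ | _] = K `&` [set z | P (z 0 o0)]) //; apply: closedI.
  exact: compact_closed cK.
by apply: closed_comp cP => z _; exact: coord_continuous.
Qed.

(** A nearest point on either side of the cut is nearest in the whole boundary;
    if the two coincided, their first coordinate would be [s]. *)
Let tie_singular x s (f : 'rV[R]_n -> R) : window x -> curved_at s ->
  [set z | K z /\ z 0 o0 <= s] !=set0 -> [set z | K z /\ s <= z 0 o0] !=set0 ->
  dist [set z | K z /\ z 0 o0 <= s] x = dist [set z | K z /\ s <= z 0 o0] x ->
  (\forall y \near x, f y = dist K y) -> ~ differentiable f x.
Proof.
move=> gx bs A0 B0 AB fK df.
have cA := half_compact (@closed_le R s); have cB := half_compact (@closed_ge R s).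
have [a [Ka as_] xa] := dist_attained cA A0 x.
have [b [Kb bs_] xb] := dist_attained cB B0 x.
have near_a : nearest_point x a.
  split=> // c Kc; rewrite -xa; have [cs|/ltW cs] := leP (c 0 o0) s.
    by apply: (dist_le cA A0).
  by rewrite AB; apply: (dist_le cB B0).
have Kxa : dist K x = enorm (x - a) by apply: dist_nearest => //; case: near_a.
have Kxb : dist K x = enorm (x - b) by rewrite Kxa -xa AB.
have ab := differentiable_dist_unique cK levelset_nonempty fK df Ka Kb Kxa Kxb.
apply: (nearest_point_not_curved gx near_a).
by have -> : a 0 o0 = s by apply/eqP; rewrite eq_le as_ ab bs_.
Qed.

(** The nearest points of the ends of a short segment have distinct first
    coordinates, hence lie on different sides of some curved value [s]; along
    the segment, the difference between the distances to the two sides changes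
    sign. *)
Lemma singular_near x e : 0 < e -> (forall y, ball x e y -> window y) ->
  exists y, ball x e y /\ forall f : 'rV[R]_n -> R,
    (\forall y' \near y, f y' = dist K y') -> ~ differentiable f y.
Proof.
move=> e0 gxe; pose r := e / 2.
have r0 : 0 < r by rewrite divr_gt0.
have xr t : 0 <= t <= r -> ball x e (slide x t).
  move=> tr; rewrite -ball_normE /= opprD addNKr normrN normrZ ger0_norm; last by lra.
  have : `|delta_mx 0 o0 : 'rV[R]_n| <= 1.
    apply: norm_le_coord => // i j; rewrite mxE.
    by case: (_ && _); rewrite ?normr1 ?normr0.
  rewrite /r in tr *; nra.
have gr t : 0 <= t <= r -> window (slide x t) by move=> tr; exact/gxe/xr.
have s0 : slide x 0 = x by rewrite /slide scale0r addr0.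
have gx : window x by rewrite -s0; apply: gr; lra.
have gx' : window (slide x r) by apply: gr; lra.
have [z Kz zP] := nearest cK levelset_nonempty x.
have [z' Kz' zP'] := nearest cK levelset_nonempty (slide x r).
have zx : nearest_point x z by [].
have zx' : nearest_point (slide x r) z' by [].
have := nearest_point_moves gx gx' r0 zx zx'.
have [+ _] := nearest_point_min gx zx; have [+ _] := nearest_point_min gx' zx'.
rewrite !ltr_norml => z'2 z2 zz'.
have [s [h [sz h0 h1 h2 h3]]] : exists s h : R,
    [/\ Num.min (z 0 o0) (z' 0 o0) < s < Num.max (z 0 o0) (z' 0 o0),
     0 < h, -2 <= s - h, s + h <= 2 &
     2 * h ^+ 2 < eta (s + h) + eta (s - h) - eta s *+ 2].
  by apply: eta_curved; move: zz'; case: (ltgtP (z 0 o0) (z' 0 o0)); lra.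
have bs : curved_at s by exists h.
pose A := [set c : 'rV[R]_n | K c /\ c 0 o0 <= s].
pose B := [set c : 'rV[R]_n | K c /\ s <= c 0 o0].
have cA : compact A := half_compact (@closed_le R s).
have cB : compact B := half_compact (@closed_ge R s).
have [A0 B0] : A !=set0 /\ B !=set0.
  move: sz zz'; case: (ltgtP (z 0 o0) (z' 0 o0)) => // _ /andP[/ltW sz /ltW sz'] _.
    by split; [exists z|exists z'].
  by split; [exists z'|exists z].
have inA y c : K c -> c 0 o0 <= s -> (forall b, K b -> enorm (y - c) <= enorm (y - b)) ->
    dist A y <= dist B y.
  move=> Kc cs cP; have [b [Kb _] ->] := dist_attained cB B0 y.
  by apply: le_trans (cP b Kb); apply: (dist_le cA A0).
have inB y c : K c -> s <= c 0 o0 -> (forall b, K b -> enorm (y - c) <= enorm (y - b)) ->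
    dist B y <= dist A y.
  move=> Kc cs cP; have [b [Kb _] ->] := dist_attained cA A0 y.
  by apply: le_trans (cP b Kb); apply: (dist_le cB B0).
pose g t := dist A (slide x t) - dist B (slide x t).
have cg : {within `[0, r], continuous g}.
  apply: continuous_subspaceT => t.
  have cs : continuous (slide x).
    by move=> t'; apply: cvgD; [exact: cvg_cst|apply: cvgZr_tmp; exact: cvg_id].
  have cdA : continuous (dist A).
    by apply: enorm_lipschitz_continuous => u v; exact: dist_lipschitz.
  have cdB : continuous (dist B).
    by apply: enorm_lipschitz_continuous => u v; exact: dist_lipschitz.
  have cgA := @continuous_comp _ _ _ (slide x) (dist A) t (cs t) (cdA _).
  have cgB := @continuous_comp _ _ _ (slide x) (dist B) t (cs t) (cdB _).
  exact: cvgB cgA cgB.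
have [|t t0r gt] := @IVT _ g 0 r 0 (ltW r0) cg.
  rewrite /g s0 ge_min le_max !subr_le0 !subr_ge0.
  move: sz zz'; case: (ltgtP (z 0 o0) (z' 0 o0)) => // _ /andP[/ltW sz /ltW sz'] _.
    by rewrite (inA x z) // (inB (slide x r) z') ?orbT.
  by rewrite (inA (slide x r) z') ?(inB x z) ?orbT.
move: t0r; rewrite in_itv /= => t0r.
exists (slide x t); split; first exact: xr.
move=> f; apply: (@tie_singular _ s) => //; first exact: gr.
by apply/eqP; rewrite -subr_eq0; apply/eqP.
Qed.

Lemma window_ball y : ball ((5/4) *: delta_mx 0 o1 : 'rV[R]_n) (1/4) y -> window y.
Proof.
rewrite -ball_normE /= => yp.
have H j : `|(5/4) * (j == o1)%:R - y 0 j| < 1/4.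
  apply: le_lt_trans yp; have := coord_le_norm ((5/4) *: delta_mx 0 o1 - y) j.
  by rewrite !mxE eqxx.
split=> [|j /negbTE j1].
  by have := H o1; rewrite eqxx mulr1 ltr_norml; lra.
by have := H j; rewrite j1 mulr0 sub0r normrN; lra.
Qed.

Lemma singular_dense (f : 'rV[R]_n -> R) :
  (forall y, barrel y < 1 -> f y = dist K y) ->
  (closure [set x | barrel x < 1 /\ ~ differentiable f x])° !=set0.
Proof.
move=> fK; pose p : 'rV[R]_n := (5/4) *: delta_mx 0 o1.
have op : open (ball p (1/4)) by apply: ball_open; lra.
exists p; have : nbhs p (ball p (1/4)) by apply: nbhsx_ballx; lra.
apply: filterS => x px B xB.
have : nbhs x (B `&` ball p (1/4)).
  by apply: filterI => //; apply: open_nbhs_nbhs.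
move=> /nbhs_ballP[e /= e0 eB].
have [|y [xy ys]] := @singular_near x e e0.
  by move=> y /eB[_]; exact: window_ball.
have [By py] := eB y xy; exists y; split=> //.
have Gy z : window z -> barrel z < 1.
  move=> gz; rewrite barrel_in_cube => [|j]; last by have := window_le2 j gz; case: gz; lra.
  have [_ /(_ o0 isT)] := gz; rewrite ltr_norml => z0.
  have := @eta_bounds (z 0 o0); lra.
split; first exact/Gy/window_ball.
apply: ys.
have : nbhs y (ball p (1/4)) by apply: open_nbhs_nbhs.
by apply: filterS => w /window_ball/Gy; exact: fK.
Qed.

End body.

Theorem theorem3p3 (R : realType) (n : nat) (hn : (2 <= n)%N) :
  exists C : set 'rV[R]_n,
    [/\ regular_convex_body C,
        C11_hypersurface (boundary C),
        (closure (singular_set (boundary C)))° !=set0,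
        eikonal_viscosity_solution setT (signed_dist C) &
        (closure [set x | ~ differentiable (signed_dist C) x])° !=set0].
Proof.
case: n hn => [//|[//|m]] _.
have [eta [eta' [deta eta'L eta0 eta'B [etaE curved]]]] := densely_curved R.
have cG : continuous (@barrel R m eta) := continuous_barrel deta eta'L.
have G0 : @barrel R m eta 0 < 1 := barrel_0 m deta eta0 eta'B.
have cC : compact (sublevel (@barrel R m eta)) :=
  compact_barrel deta eta'L eta0 eta'B.
have sg := @barrel_subgradient R m eta eta' deta eta'L.
have K0 := @levelset_nonempty R m eta eta' deta eta0 eta'B.
have hyp : C11_hypersurface [set z | @barrel R m eta z = 1].
  exact: (C11_levelset deta eta'L eta0 eta'B etaE).
have bC : boundary (sublevel (@barrel R m eta)) = [set z | @barrel R m eta z = 1].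
  exact: boundary_sublevel.
have dense := @singular_dense R m eta eta' deta eta'L eta0 eta'B curved.
exists (sublevel (@barrel R m eta)); split.
- split=> //.
  + exact: sublevel_convex.
  + by exists 0; exact: sublevel_interior.
  + by rewrite bC; exact: C11_C1_hypersurface.
- by rewrite bC.
- rewrite bC; apply: (subset_nonempty _ (dense _ _)) => //.
  apply: interiorS; apply: closureS => x [Gx nd]; split=> //=.
  by apply/eqP; rewrite lt_eqF.
- exact: signed_dist_eikonal.
- apply: (subset_nonempty _ (dense (signed_dist (sublevel (@barrel R m eta))) _)).
    by apply: interiorS; apply: closureS => x [].
  by move=> y Gy; apply: (signed_dist_in cG G0 sg); exact: ltW.
Qed.
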